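(* Let $K=\mathbf{C}$, let $\mathcal{N}\subset K^{n\times n}$ be the variety of nilpotent $n\times n$ matrices, and let $U\subset\mathrm{GL}_n(K)$ be the group of upper-triangular matrices with all diagonal entries equal to $1$, acting on $\mathcal{N}$ by conjugation. Then the $U$-invariant ring $K[\mathcal{N}]^U$ is spanned (as a $K$-vector space) by the $U$-invariant functions $f^{\mathcal{P}}$, where $\mathcal{P}$ runs through all data as described in the context.
   Context: For $a,b\in\{0,\dots,n\}$ and a matrix $M\in K^{n\times n}$, $M_{(a,b)}\in K^{a\times b}$ denotes the submatrix formed by the last $a$ rows and the first $b$ columns of $M$. A datum $\mathcal{P}=((a_i)_i,(a'_j)_j,(\mathcal{P}_{i,j})_{i,j})$ consists of positive integers $s,t$, integers $a_1,\dots,a_s,a'_1,\dots,a'_t\in\{1,\dots,n\}$ with $a_1+\dots+a_s=a'_1+\dots+a'_t=:r$, and polynomials $\mathcal{P}_{i,j}(x)\in K[x]$ for $1\le i\le s$, $1\le j\le t$. For $N\in\mathcal{N}$ let $N^{\mathcal{P}}$ be the $r\times r$ block matrix $\left(\mathcal{P}_{i,j}(N)_{(a_i,a'_j)}\right)_{i,j}$, whose $(i,j)$ block is the $a_i\times a'_j$ matrix $\mathcal{P}_{i,j}(N)_{(a_i,a'_j)}$, and set $f^{\mathcal{P}}(N)=\det(N^{\mathcal{P}})$. Each $f^{\mathcal{P}}$ is a semi-invariant regular function on $\mathcal{N}$ for the group $B$ of invertible upper-triangular matrices, and hence a $U$-invariant function. *)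

(* Defs.v *)
From HB Require Import structures.
From mathcomp Require Import all_boot all_order all_algebra.
From mathcomp Require Import complex mpoly reals.

Set Implicit Arguments.
Unset Strict Implicit.
Unset Printing Implicit Defensive.

Import GRing.Theory.
Local Open Scope ring_scope.

(* Matrices are of size n.+1, so that they form a nontrivial ring: n.+1 is the
   size that is usually called n. *)

Definition nilpotent_mx (K : fieldType) (n : nat) (N : 'M[K]_n.+1) : Prop :=
  exists k : nat, N ^+ k = 0.

Definition nilpotent_cone (K : fieldType) (n : nat) : Type :=
  {N : 'M[K]_n.+1 | nilpotent_mx N}.

(* [is_trig_mx] means lower triangular, hence the transpose. *)
Definition upper_unitriangular (K : fieldType) (n : nat) (u : 'M[K]_n.+1) : bool :=
  is_trig_mx u^T && [forall i, u i i == 1].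

Lemma upper_unitriangular_unit (K : fieldType) (n : nat) (u : 'M[K]_n.+1) :
  upper_unitriangular u -> u \is a GRing.unit.
Proof.
case/andP=> /det_trig det_u /forallP u1.
change (u \in unitmx).
rewrite unitmxE -det_tr det_u big1 ?unitr1 // => i _.
by rewrite mxE; apply/eqP.
Qed.

Lemma nilpotent_mx_conj (K : fieldType) (n : nat) (u N : 'M[K]_n.+1) :
  u \is a GRing.unit -> nilpotent_mx N -> nilpotent_mx (u * N * u^-1).
Proof.
move=> Uu [k Nk0]; exists k.
suff -> : (u * N * u^-1) ^+ k = u * N ^+ k * u^-1 by rewrite Nk0 mulr0 mul0r.
elim: k {Nk0} => [|k IHk]; first by rewrite !expr0 mulr1 divrr.
by rewrite !exprS IHk !mulrA divrK.
Qed.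

Definition conj_cone (K : fieldType) (n : nat) (u : 'M[K]_n.+1)
    (Uu : upper_unitriangular u) (N : nilpotent_cone K n) : nilpotent_cone K n :=
  exist _ (u * sval N * u^-1)
    (nilpotent_mx_conj (upper_unitriangular_unit Uu) (svalP N)).

(* The coordinate ring of the (reduced) variety of nilpotent matrices: the
   restrictions of the polynomial functions in the matrix entries. *)
Definition regular_function (K : fieldType) (n : nat)
    (f : nilpotent_cone K n -> K) : Prop :=
  exists p : {mpoly K[n.+1 * n.+1]},
    forall N, f N = p.@[fun k => mxvec (sval N) 0 k].

Definition U_invariant (K : fieldType) (n : nat)
    (f : nilpotent_cone K n -> K) : Prop :=
  forall (u : 'M[K]_n.+1) (Uu : upper_unitriangular u) (N : nilpotent_cone K n),
    f (conj_cone Uu N) = f N.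

Definition U_invariant_ring (K : fieldType) (n : nat)
    (f : nilpotent_cone K n -> K) : Prop :=
  regular_function f /\ U_invariant f.

(* The last a rows and first b columns of M; only meaningful for a, b <= n.+1,
   in which case the arguments of [inord] are in range. *)
Definition corner_mx (K : fieldType) (n : nat) (M : 'M[K]_n.+1) (a b : nat) :
    'M[K]_(a, b) :=
  \matrix_(i < a, j < b) M (inord (n.+1 - a + i)) (inord j).

Record datum (K : fieldType) (n : nat) := Datum {
  nrows : nat;
  ncols : nat;
  nrows_gt0 : (0 < nrows)%N;
  ncols_gt0 : (0 < ncols)%N;
  row_size : 'I_nrows -> nat;
  col_size : 'I_ncols -> nat;
  row_size_bound : forall i, (1 <= row_size i <= n.+1)%N;
  col_size_bound : forall j, (1 <= col_size j <= n.+1)%N;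
  sum_sizes : (\sum_i row_size i = \sum_j col_size j)%N;
  datum_poly : 'I_nrows -> 'I_ncols -> {poly K}
}.
Arguments row_size {K n} d i.
Arguments col_size {K n} d j.
Arguments sum_sizes {K n} d.
Arguments datum_poly {K n} d i j.

Definition datum_mx (K : fieldType) (n : nat) (P : datum K n) (N : 'M[K]_n.+1) :
    'M[K]_(\sum_i row_size P i) :=
  castmx (erefl, esym (sum_sizes P))
    (\mxblock_(i, j)
       corner_mx (horner_mx N (datum_poly P i j)) (row_size P i) (col_size P j)).

Definition datum_fun (K : fieldType) (n : nat) (P : datum K n)
    (N : nilpotent_cone K n) : K :=
  \det (datum_mx P (sval N)).

Definition in_span (K : fieldType) (T I : Type) (e : I -> T -> K) (f : T -> K) :
    Prop :=
  exists (m : nat) (c : 'I_m -> K) (x : 'I_m -> I),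
    forall t, f t = \sum_(k < m) c k * e (x k) t.

(* Main.v *)
Require Import Defs.
From mathcomp Require Import all_boot all_order all_algebra all_fingroup.
From mathcomp Require Import spectral sesquilinear mpoly.
From mathcomp Require Import boolp complex reals zify.

(** Write [G] for the general linear group and [U] for the unitriangular group,
    and let [f] be a [U]-invariant function on the cone, the restriction of a
    polynomial [p]. The functions attached to data are regular and invariant
    because a product of [u] with a corner of a matrix only involves a
    unitriangular corner of [u] (section [EasyDirection]). The converse moves
    the problem to multilinear algebra.

    Transfer. For invertible [g] and nilpotent [N] put [M = N g] and consider
    [F (g, M) = det g ^ d * p (g^-1 M)], which for large [d] is a form of some
    degree [r] in the entries of the two matrices [g] and [M]
    (lemma [clear_denominators]), with [F (1, N) = f N]. On the set [Y] of these
    pairs [(g, N g)] it does not change when both matrices are multiplied on the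
    left, or both on the right, by a unitriangular matrix. The point is that
    the two multiplications are independent, whereas conjugation acts on the
    rows and on the columns of [N] at the same time.

    Lifting. The form [F] is invariant on [Y] only, not identically. Its tensor
    of coefficients can be projected orthogonally onto the span of the conjugates
    of the tensor powers of the points of [Y]; this does not change [F] on [Y],
    and makes the tensor itself invariant, since [Y] is stable under adjoint
    matrices (lemma [invariant_tensor]). This replaces the complete reducibility
    of the representations of [G].

    Classification. The tensor, as a function of its row indices and as a
    function of its column indices, is then a highest weight vector of a tensor
    power of the standard representation. Such vectors are combinations of
    permuted products of elementary antisymmetric tensors, one for each column of
    a tableau (lemma [highest_weight_span]). So [F] is a combination of the forms
    obtained by contracting the powers of [(g, M)] with one product of
    antisymmetric tensors on the rows and another one on the columns.

    Determinants. By inclusion-exclusion over the set of slots such a contraction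
    is a combination of determinants of block matrices, whose blocks are
    combinations of a corner of [g] and of the same corner of [M]
    (lemma [pairing_sum_det]). At [(1, N)] the block is a corner of a polynomial
    in [N], and the determinant is, up to sign, the function of a datum
    (lemma [box_mx_datum]). *)


Set Implicit Arguments.
Unset Strict Implicit.
Unset Printing Implicit Defensive.

Import Order.TTheory GRing.Theory Num.Theory.
Local Open Scope ring_scope.

(** * Spans of functions *)

Section Span.
Variables (K : fieldType) (T I : Type) (e : I -> T -> K).
Implicit Types f g : T -> K.

Lemma in_span_ext f g : f =1 g -> in_span e f -> in_span e g.
Proof. by move=> fg [m [c [x fE]]]; exists m, c, x => t; rewrite -fg. Qed.

Lemma in_span0 : in_span e (fun=> 0).
Proof.
exists 0, (fun=> 0), (fun i : 'I_0 => match notF (ltn_ord i) with end) => t.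
by rewrite big_ord0.
Qed.

Lemma in_span_gen i : in_span e (e i).
Proof. by exists 1, (fun=> 1), (fun=> i) => t; rewrite big_ord1 mul1r. Qed.

Lemma in_spanZ a f : in_span e f -> in_span e (fun t => a * f t).
Proof.
move=> [m [c [x fE]]]; exists m, (fun k => a * c k), x => t.
by rewrite fE mulr_sumr; apply: eq_bigr => k _; rewrite mulrA.
Qed.

Lemma in_spanD f g :
  in_span e f -> in_span e g -> in_span e (fun t => f t + g t).
Proof.
move=> [m [c [x fE]]] [m' [c' [x' gE]]].
exists (m + m')%N, (fun k => match split k with inl i => c i | inr i => c' i end).
exists (fun k => match split k with inl i => x i | inr i => x' i end) => t.
rewrite fE gE big_split_ord /=; congr (_ + _); apply: eq_bigr => k _.
  by rewrite (unsplitK (inl k)).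
by rewrite (unsplitK (inr k)).
Qed.

Lemma in_span_sum (J : Type) (r : seq J) (P : pred J) (F : J -> T -> K) :
  (forall j, P j -> in_span e (F j)) ->
  in_span e (fun t => \sum_(j <- r | P j) F j t).
Proof.
move=> eF; elim: r => [|j r IHr].
  by apply: in_span_ext in_span0 => t; rewrite big_nil.
case Pj: (P j); last by apply: in_span_ext IHr => t; rewrite big_cons Pj.
apply: in_span_ext (in_spanD (eF j Pj) IHr) => t.
by rewrite big_cons Pj.
Qed.

End Span.

Lemma in_span_trans (K : fieldType) (T I J : Type) (e : I -> T -> K)
    (e' : J -> T -> K) (f : T -> K) :
  (forall i, in_span e' (e i)) -> in_span e f -> in_span e' f.
Proof.
move=> ee' [m [c [x fE]]].
apply: (@in_span_ext _ _ _ _ (fun t => \sum_(k < m) c k * e (x k) t)).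
  by move=> t; rewrite fE.
by apply: in_span_sum => k _; apply: in_spanZ.
Qed.

(** * Raising operators on tensors *)

Section Words.
Variables (L : eqType) (X : finType).
Local Notation word := {ffun X -> L}.
Implicit Types (D : {set X}) (a b : L) (v w : word).

Definition upd w x a : word := [ffun z => if z == x then a else w z].

(** The weight of the basis tensor with letters [w], in the slots of [D]. *)
Definition content D w a := #|[set x in D | w x == a]|.

Lemma updE w x a z : upd w x a z = if z == x then a else w z.
Proof. by rewrite ffunE. Qed.

Lemma upd_id w x a : upd w x a x = a.
Proof. by rewrite updE eqxx. Qed.

Lemma upd_other w x a z : z != x -> upd w x a z = w z.
Proof. by rewrite updE => /negbTE->. Qed.

Lemma upd_twice w x a b : upd (upd w x a) x b = upd w x b.
Proof. by apply/ffunP=> z; rewrite !updE; case: eqP. Qed.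

Lemma upd_same w x : upd w x (w x) = w.
Proof. by apply/ffunP=> z; rewrite updE; case: eqP => [->|]. Qed.

Lemma updC w x y a b : x != y -> upd (upd w x a) y b = upd (upd w y b) x a.
Proof.
move=> xy; apply/ffunP=> z; rewrite !updE.
by case: eqP => [->|//]; case: eqP => // yx; rewrite yx eqxx in xy.
Qed.

Lemma content_sum D w a : content D w a = (\sum_(x in D) (w x == a))%N.
Proof.
rewrite /content -sum1_card big_mkcond [RHS]big_mkcond /=.
by apply: eq_bigr => x _; rewrite inE; case: (x \in D); case: (w x == a).
Qed.

Lemma content_setU1 D w x a : x \notin D ->
  content (x |: D) w a = ((w x == a) + content D w a)%N.
Proof. by move=> xD; rewrite !content_sum big_setU1. Qed.

Lemma eq_content D v w a : {in D, v =1 w} -> content D v a = content D w a.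
Proof. by move=> vw; rewrite !content_sum; apply: eq_bigr => x /vw->. Qed.

Lemma content_upd D w x b a : x \notin D ->
  content (x |: D) (upd w x b) a = ((b == a) + content D w a)%N.
Proof.
move=> xD; rewrite content_setU1 // upd_id; congr (_ + _)%N.
apply: eq_content => z zD; rewrite upd_other //.
by apply: contraNneq xD => <-.
Qed.

End Words.

Section Operators.
Variables (K : numClosedFieldType) (n : nat) (X : finType).
Local Notation word := {ffun X -> 'I_n}.
Implicit Types (D : {set X}) (a b : 'I_n) (v w : word) (T : word -> K).

(** The action of an elementary matrix on the tensor with coefficients [T], in
    the tensor slots belonging to [D]. *)
Definition polarize D a b T w : K :=
  \sum_(x in D | w x == a) T (upd w x b).

(** The raising operators of the simple roots suffice to express invariance
    under the unitriangular group. *)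
Definition highest D T :=
  forall a b, b = a.+1 :> nat -> forall w, polarize D a b T w = 0.

(** For a fixed slot, exchanging the two letters there is a bijection from the
    words counted by one operator to those counted by the other. *)
Lemma polarize_adjoint D a b T T' :
  \sum_w polarize D b a T w * T' w = \sum_w T w * polarize D a b T' w.
Proof.
under eq_bigr do rewrite mulr_suml.
under [RHS]eq_bigr do rewrite mulr_sumr.
rewrite (exchange_big_dep (mem D)) /=; last by move=> w x _ /andP[].
rewrite [RHS](exchange_big_dep (mem D)) /=; last by move=> w x _ /andP[].
apply: eq_bigr => x xD; rewrite xD /=.
rewrite (reindex_onto (fun w => upd w x b) (fun w => upd w x a)) /=; last first.
  by move=> w /eqP<-; rewrite upd_twice upd_same.
apply: eq_big => [w|w].
  rewrite upd_twice upd_id eqxx /=; apply/eqP/eqP => [<-|<-].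
    by rewrite upd_id.
  by rewrite upd_same.
by move=> /andP[_ /eqP->].
Qed.

Lemma polarize_twice D a b T w : a != b ->
  polarize D a b (polarize D b a T) w = (content D w a)%:R * T w +
    \sum_(x in D | w x == a) \sum_(z in D | w z == b) T (upd (upd w x b) z a).
Proof.
move=> ab; rewrite /polarize.
transitivity (\sum_(x in D | w x == a)
   (T w + \sum_(z in D | w z == b) T (upd (upd w x b) z a))).
  apply: eq_bigr => x /andP[xD /eqP wx].
  rewrite (bigD1 x) /=; last by rewrite xD upd_id eqxx.
  rewrite upd_twice -wx upd_same wx; congr (_ + _); apply: eq_bigl => z.
  rewrite updE -andbA; congr (_ && _); case: (eqVneq z x) => [->|_].
    by rewrite wx (negbTE ab) andbF.
  by rewrite andbT.
rewrite big_split /=; congr (_ + _).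
rewrite sumr_const /content mulr_natl; congr (_ *+ _).
by apply: eq_card => x; rewrite !inE.
Qed.

(** The commutation relation of the Lie algebra sl_2. *)
Lemma polarize_comm D a b T w : a != b ->
  polarize D a b (polarize D b a T) w + (content D w b)%:R * T w =
  polarize D b a (polarize D a b T) w + (content D w a)%:R * T w.
Proof.
move=> ab; rewrite polarize_twice // polarize_twice 1?eq_sym //.
rewrite -addrA [LHS]addrC -[RHS]addrA [RHS]addrC -!addrA; congr (_ + _).
  rewrite exchange_big /=; apply: eq_bigr => z /andP[_ /eqP wz].
  apply: eq_bigr => x /andP[_ /eqP wx]; rewrite updC //.
  by apply: contraNneq ab => xz; rewrite -wx -wz xz.
by rewrite addrC.
Qed.

(** A vector killed by the raising operator of an sl_2 has nonnegative weight:
    if [E T = 0] then the squared norm of [F T] is the weight of [T] times the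
    squared norm of [T], because [F] is the adjoint of [E]. *)
Lemma highest_dominant D a b T (la lb : nat) : a != b ->
  (forall w, polarize D a b T w = 0) ->
  (forall w, T w != 0 -> content D w a = la /\ content D w b = lb) ->
  (exists w, T w != 0) -> (lb <= la)%N.
Proof.
move=> ab ET cT [w0 Tw0].
pose N (S : word -> K) := \sum_w S w * (S w)^*.
have N_ge0 S : 0 <= N S by apply: sumr_ge0 => w _; apply: mul_conjC_ge0.
have NT_gt0 : 0 < N T.
  rewrite /N (bigD1 w0) //= ltr_wpDr ?mul_conjC_gt0 //.
  by apply: sumr_ge0 => w _; apply: mul_conjC_ge0.
have conj_polarize S w : (polarize D b a S w)^* =
    polarize D b a (fun v => (S v)^*) w by rewrite rmorph_sum.
have conj_polarize' S w : (polarize D a b S w)^* =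
    polarize D a b (fun v => (S v)^*) w by rewrite rmorph_sum.
have key : N (polarize D b a T) + lb%:R * N T = la%:R * N T.
  rewrite /N; under eq_bigr do rewrite conj_polarize.
  rewrite polarize_adjoint !mulr_sumr -big_split /=.
  apply: eq_bigr => w _; rewrite mulrCA -mulrDr [RHS]mulrCA.
  have [->|/cT[ca cb]] := eqVneq (T w) 0; first by rewrite !mul0r.
  congr (_ * _); rewrite -ca -cb polarize_comm // [X in X + _](_ : _ = 0) ?add0r //.
  rewrite /polarize big1 // => x _.
  by rewrite -/(polarize D a b (fun v => (T v)^*) _) -conj_polarize' ET rmorph0.
rewrite leqNgt; apply/negP => lab.
suff: N (polarize D b a T) < 0 by rewrite le_gtF.
have -> : N (polarize D b a T) = (la%:R - lb%:R) * N T.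
  by rewrite mulrBl -key addrK.
by rewrite pmulr_llt0 // subr_lt0 ltr_nat.
Qed.

Lemma polarize_sum D a b (m : nat) (c : 'I_m -> K) (F : 'I_m -> word -> K) w :
  polarize D a b (fun v => \sum_(k < m) c k * F k v) w =
  \sum_(k < m) c k * polarize D a b (F k) w.
Proof.
by rewrite /polarize exchange_big /=; under [RHS]eq_bigr do rewrite mulr_sumr.
Qed.

Lemma polarizeB D a b T T' w :
  polarize D a b (fun v => T v - T' v) w =
  polarize D a b T w - polarize D a b T' w.
Proof. by rewrite /polarize sumrB. Qed.

End Operators.

(** * Column tensors *)

Section Tableaux.
Variables (K : numClosedFieldType) (n : nat) (X : finType).
Local Notation word := {ffun X -> 'I_n}.
Implicit Types (D : {set X}) (a b : 'I_n) (v w y : word) (T : word -> K).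
Implicit Types (phi : {ffun X -> X}) (s : {perm X}).

(** A filling of the slots in [D] by the boxes of a Young diagram with unordered
    columns: [phi] names the column and [y] the height, counted from 0, of the
    box in a slot. Column names lie in [D], so that a slot outside [D] names a
    fresh column. *)
Definition tableau D phi y : bool :=
  [&& [forall x in D, phi x \in D],
      [forall x in D, forall z in D, (phi x == phi z) && (y x == y z) ==> (x == z)]
    & [forall x in D, forall a : 'I_n, (a < y x)%N ==>
         [exists z in D, (phi z == phi x) && (y z == a)]]].

Lemma tableauP D phi y :
  reflect [/\ forall x, x \in D -> phi x \in D,
              {in D &, forall x z, phi x = phi z -> y x = y z -> x = z}
            & forall x a, x \in D -> (a < y x)%N ->
                exists z, [/\ z \in D, phi z = phi x & y z = a]]
          (tableau D phi y).
Proof.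
apply: (iffP and3P) => [[/forall_inP h1 /forall_inP h2 /forall_inP h3]|[h1 h2 h3]].
  split=> //.
    move=> x z xD zD pxz yxz; have /forall_inP/(_ z zD) := h2 x xD.
    by rewrite pxz yxz !eqxx => /eqP.
  move=> x a xD ax; have /forallP/(_ a) := h3 x xD.
  by rewrite ax => /exists_inP[z zD /andP[/eqP pz /eqP yz]]; exists z.
split; first exact/forall_inP.
  apply/forall_inP => x xD; apply/forall_inP => z zD; apply/implyP.
  by move=> /andP[/eqP pxz /eqP yxz]; apply/eqP; apply: h2.
apply/forall_inP => x xD; apply/forallP => a; apply/implyP => ax.
have [z [zD pz yz]] := h3 x a xD ax.
by apply/exists_inP; exists z => //; rewrite pz yz !eqxx.
Qed.

Definition column_perm D phi s :=
  perm_on D s && [forall x in D, phi (s x) == phi x].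

(** The product, over the columns, of the exterior powers of the first basis
    vectors, placed in the slots of the columns. *)
Definition column_tensor D phi y w : K :=
  \sum_(s | column_perm D phi s)
     (-1) ^+ s * [forall x in D, w x == y (s x)]%:R.

Lemma column_permP D phi s :
  reflect (perm_on D s /\ {in D, forall x, phi (s x) = phi x})
          (column_perm D phi s).
Proof.
apply: (iffP andP) => -[sD] => [/forall_inP h|h]; split=> //.
  by move=> x /h/eqP.
by apply/forall_inP=> x /h/eqP.
Qed.

Lemma column_tensor_content D phi y w :
  column_tensor D phi y w != 0 -> content D w =1 content D y.
Proof.
move=> tw a.
have [s /column_permP[sD _] /forall_inP wE] : exists2 s, column_perm D phi s &
    [forall x in D, w x == y (s x)].
  apply/exists_inP; apply: contraR tw; rewrite negb_exists_in => /forall_inP h.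
  by apply/eqP; rewrite /column_tensor big1 // => s /h/negbTE->; rewrite mulr0.
rewrite !content_sum [RHS](reindex_inj (@perm_inj _ s)) /=.
apply: eq_big => [x|x /wE/eqP->//]; by rewrite perm_closed.
Qed.

(** Raising a letter [b] to [a] in a column that contains both gives a column
    with a repeated letter: the terms cancel in pairs, through the
    transposition of the two slots [x], [x'] which carry the letter [a]. *)
Lemma column_tensor_highest D phi y :
  tableau D phi y -> highest D (column_tensor D phi y).
Proof.
move=> /tableauP[h1 h2 h3] a b bE w.
have ab : a != b by apply: contra_eqN bE => /eqP->; rewrite neq_ltn ltnSn.
pose mates x x' := [&& x \in D, x' \in D, x != x' & phi x == phi x'].
pose Q x x' s := [&& column_perm D phi s, mates x x', w x == a, w x' == a
  & [forall z in D, upd w x b z == y (s z)]].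
pose f x x' : K := \sum_(s | Q x x' s) (-1) ^+ s.
have -> : polarize D a b (column_tensor D phi y) w = \sum_x \sum_x' f x x'.
  rewrite /polarize /column_tensor big_mkcond /=; apply: eq_bigr => x _.
  rewrite /f (exchange_big_dep (column_perm D phi)) /=; last first.
    by move=> x' s _ /andP[].
  case: ifPn => [/andP[xD /eqP wx]|nx]; last first.
    rewrite big1 // => s _; rewrite big_pred0 // => x'.
    by apply: contraNF nx => /and5P[_ /and4P[-> _ _ _] -> _ _].
  apply: eq_bigr => s cs; rewrite /Q /mates cs xD wx eqxx /=.
  case: (boolP [forall z in D, _]) => [ok|_]; last first.
    by rewrite mulr0 big_pred0 // => x'; rewrite !andbF.
  have [sD sphi] := column_permP _ _ _ cs.
  have wE z : z \in D -> upd w x b z = y (s z) by move/forall_inP: ok => h /h/eqP.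
  have [z [zD pz yz]] : exists z, [/\ z \in D, phi z = phi (s x) & y z = a].
    by apply: h3; rewrite ?perm_closed // -wE // upd_id bE.
  pose x' := (s^-1)%g z.
  have sx' : s x' = z by rewrite permKV.
  have x'D : x' \in D by rewrite -(perm_closed _ sD) sx'.
  have px' : phi x = phi x' by rewrite -[RHS]sphi // sx' pz sphi.
  have xx' : x != x'.
    apply: contraNneq ab => xE; rewrite -yz -sx' -xE -wE // upd_id; exact/eqP.
  rewrite (big_pred1 x') ?mulr1 // => t /=; rewrite andbT.
  apply/idP/eqP => [/andP[/and3P[tD xt /eqP pt] /eqP wt]|->]; last first.
    by rewrite x'D xx' px' eqxx /= -yz -sx' -wE // upd_other ?eqxx // eq_sym.
  apply: (@perm_inj _ s); rewrite sx'; apply: h2; rewrite ?perm_closed //.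
    by rewrite sphi // pz sphi.
  by rewrite -wE // upd_other ?yz // eq_sym.
have fN x x' : f x x' = - f x' x.
  have [<-|xx'] := eqVneq x x'.
    by rewrite /f !big_pred0 ?oppr0 // => s; rewrite /Q /mates eqxx /= !andbF.
  rewrite /f (reindex_inj (mulgI (tperm x x'))) /= -sumrN.
  have Qimp u u' s : u != u' -> Q u u' s -> Q u' u (tperm u u' * s)%g.
    move=> uu' /and5P[/column_permP[sD sphi] /and4P[uD u'D _ /eqP pu]].
    move=> /eqP wu /eqP wu' ok.
    have tD : perm_on D (tperm u u').
      by apply/subsetP => z; rewrite inE; case: tpermP => [->|->|_ _]; rewrite ?eqxx.
    have tphi z : phi (tperm u u' z) = phi z by case: tpermP => // ->.
    rewrite /Q /mates uD u'D eq_sym uu' pu wu wu' !eqxx /= andbC; apply/andP; split.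
      move/forall_inP: ok => ok; apply/forall_inP => z zD; rewrite permM.
      rewrite updE; case: (eqVneq z u') => [->|zu'].
        by rewrite tpermR; have /eqP <- := ok u uD; rewrite upd_id.
      have [->|zu] := eqVneq z u.
        rewrite tpermL; have /eqP <- := ok u' u'D; rewrite upd_other ?wu ?wu' //.
        by rewrite eq_sym.
      rewrite tpermD 1?eq_sym //; have /eqP <- := ok z zD.
      by rewrite upd_other.
    apply/column_permP; split; first exact: perm_onM.
    by move=> z zD; rewrite permM sphi ?perm_closed.
  apply: eq_big => [s|s _]; last first.
    by rewrite odd_permM odd_tperm xx' /= signrN.
  apply/idP/idP => [/(Qimp _ _ _ xx')|]; first by rewrite mulgA tperm2 mul1g.
  by rewrite eq_sym in xx' => /(Qimp _ _ _ xx'); rewrite tpermC.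
set S := \sum_x _; have SN : S = - S.
  rewrite {1}/S exchange_big /S -sumrN; apply: eq_bigr => x' _.
  by rewrite -sumrN; apply: eq_bigr => x _.
have : S *+ 2 == 0 by rewrite mulr2n {2}SN subrr.
by rewrite mulrn_eq0 => /eqP.
Qed.
End Tableaux.

(** * Highest weight vectors of tensor powers *)

Section HighestWeightTensors.
Variables (K : numClosedFieldType) (n : nat) (X : finType).
Local Notation word := {ffun X -> 'I_n}.
Implicit Types (D : {set X}) (a b : 'I_n) (v w y : word) (T : word -> K).
Implicit Types (phi : {ffun X -> X}) (s : {perm X}).

Definition set_column phi x l : {ffun X -> X} :=
  [ffun z => if z == x then l else phi z].

(** Placing a new slot [x] on top of the column [l], which has height [k]. *)
Section NewBox.
Variables (D : {set X}) (x : X) (phi : {ffun X -> X}) (y : word).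
Variables (l : X) (k : 'I_n).
Hypotheses (xD : x \notin D) (tab : tableau D phi y) (lD : l \in x |: D).
Hypothesis low : forall z, z \in D -> phi z = l -> (y z < k)%N.
Hypothesis full : forall a, (a < k)%N -> exists z, [/\ z \in D, phi z = l & y z = a].

Let phi' := set_column phi x l.
Let y' := upd y x k.

Let phix : phi' x = l. Proof. by rewrite /phi' ffunE eqxx. Qed.
Let yx : y' x = k. Proof. exact: upd_id. Qed.
Let neq_x z : z \in D -> z != x. Proof. by apply: contraTneq => ->. Qed.
Let phiD z : z \in D -> phi' z = phi z.
Proof. by move=> /neq_x/negbTE zx; rewrite ffunE zx. Qed.
Let yD z : z \in D -> y' z = y z. Proof. by move=> /neq_x; exact: upd_other. Qed.

Lemma tableau_new_box : tableau (x |: D) phi' y'.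
Proof.
have [h1 h2 h3] := tableauP _ _ _ tab.
apply/tableauP; split.
- move=> z /setU1P[->|zD]; first by rewrite phix.
  by rewrite phiD // setU1r ?h1.
- move=> z z' /setU1P[->|zD] /setU1P[->|zD'] //.
  + rewrite phix yx phiD // yD // => e ek; have := low zD' (esym e).
    by rewrite ek ltnn.
  + rewrite phix yx phiD // yD // => e ek; have := low zD e.
    by rewrite ek ltnn.
  + by rewrite !phiD // !yD //; apply: h2.
- move=> z a /setU1P[->|zD].
    rewrite yx phix => /full[t [tD pt yt]]; exists t.
    by rewrite phiD // yD // setU1r.
  rewrite yD // phiD // => /(h3 z a zD)[t [tD pt yt]]; exists t.
  by rewrite phiD // yD // setU1r.
Qed.

(** A permutation that contributes must fix the new slot, since the other boxes
    of its column carry letters smaller than [k]. *)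
Lemma column_tensor_new_box (i : 'I_n) w : (k <= i)%N ->
  column_tensor K (x |: D) phi' y' (upd w x i) =
  (i == k)%:R * column_tensor K D phi y w.
Proof.
move=> ki; rewrite /column_tensor mulr_sumr big_mkcond [RHS]big_mkcond /=.
apply: eq_bigr => s _.
have [sx|sx] := eqVneq (s x) x; last first.
  rewrite [in RHS](_ : column_perm D phi s = false); last first.
    by apply: contraNF sx => /andP[sD _]; rewrite (out_perm sD).
  case: column_permP => // -[sD sphi].
  have sxD : s x \in D.
    have : s x \in x |: D by rewrite perm_closed // setU11.
    by rewrite in_setU1 (negbTE sx).
  have lt_k : (y (s x) < k)%N.
    by apply: low => //; rewrite -phiD // sphi ?setU11.
  rewrite (_ : [forall _ in _, _] = false) ?mulr0 //; apply/negbTE.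
  rewrite negb_forall_in; apply/exists_inP; exists x; first exact: setU11.
  rewrite upd_id yD //; apply: contraTneq lt_k => <-; by rewrite -leqNgt.
have -> : column_perm (x |: D) phi' s = column_perm D phi s.
  apply/column_permP/column_permP => -[sD sphi]; split.
  - apply/subsetP => z; rewrite inE => sz.
    have /setU1P[zx|//] : z \in x |: D by move/subsetP: sD; apply; rewrite inE.
    by rewrite zx sx eqxx in sz.
  - move=> z zD; have := sphi z (setU1r _ zD); rewrite (phiD zD).
    have : s z \in x |: D by rewrite perm_closed // setU1r.
    case/setU1P => [sz|/phiD->//].
    by move: (neq_x zD); rewrite -(inj_eq (@perm_inj _ s)) sz sx eqxx.
  - by apply: subset_trans sD _; apply: subsetUr.
  - move=> z /setU1P[->|zD]; first by rewrite sx.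
    by rewrite !phiD ?perm_closed // sphi.
case: ifPn => // /column_permP[sD _].
rewrite mulrCA -natrM mulnb; congr (_ * _%:R).
have -> : [forall z in x |: D, upd w x i z == y' (s z)] =
    (i == k) && [forall z in D, w z == y (s z)]; last by [].
apply/forall_inP/andP => [h|[ik /forall_inP h] z /setU1P[->|zD]].
- split; first by have := h x (setU11 _ _); rewrite upd_id sx yx.
  apply/forall_inP => z zD; have := h z (setU1r _ zD).
  by rewrite upd_other ?neq_x // yD // perm_closed.
- by rewrite upd_id sx yx.
- by rewrite upd_other ?neq_x // yD ?perm_closed // h.
Qed.

End NewBox.

(** When there are fewer boxes of height [k] than of height [k.-1], some column
    stops below height [k]; for [k = 0] the new slot starts a column. *)
Lemma exists_column D phi y (k : 'I_n) : tableau D phi y ->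
  (forall a, k = a.+1 :> nat -> (content D y k < content D y a)%N) ->
  forall x, x \notin D -> exists l,
    [/\ l \in x |: D, forall z, z \in D -> phi z = l -> (y z < k)%N
      & forall a, (a < k)%N -> exists z, [/\ z \in D, phi z = l & y z = a]].
Proof.
move=> /tableauP[h1 h2 h3] dom x xD.
have [k0|k_gt0] := posnP k.
  exists x; split=> [|z zD pz|a]; first exact: setU11; last by rewrite k0.
  by have := h1 z zD; rewrite pz (negbTE xD).
have ltk : (k.-1 < n)%N by apply: leq_ltn_trans (leq_pred k) _.
pose a0 := Ordinal ltk; have kE : k = a0.+1 :> nat by rewrite /= prednK.
(* If each box of height [k.-1] had a box of height [k] above it, there would be
   at least as many boxes of height [k]. *)
have [m /andP[mD /eqP ym] top] : exists2 m, (m \in D) && (y m == a0) &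
    ~~ [exists z in D, (phi z == phi m) && (y z == k)].
  apply/exists_inP; have := dom a0 kE; apply: contraTT.
  rewrite negb_exists_in => /forall_inP above; rewrite -leqNgt.
  pose above_of m := odflt m [pick z in D | (phi z == phi m) && (y z == k)].
  have aboveP m : (m \in D) && (y m == a0) ->
      [/\ above_of m \in D, phi (above_of m) = phi m & y (above_of m) = k].
    move=> /above; rewrite negbK => /exists_inP[z zD pz]; rewrite /above_of.
    case: pickP => [t /and3P[tD /eqP pt /eqP yt]|/(_ z)]; first by [].
    by rewrite zD pz.
  rewrite /content -(card_in_imset (f := above_of)); last first.
    move=> u v; rewrite !inE => uD vD uv.
    have [_ pu _] := aboveP u uD; have [_ pv _] := aboveP v vD.
    move/andP: uD vD => [uD /eqP yu] /andP[vD /eqP yv].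
    by apply: h2; rewrite ?yu ?yv // -pu -pv uv.
  apply/subset_leq_card/subsetP => _ /imsetP[u + ->].
  by rewrite !inE => /aboveP[-> _ ->]; rewrite eqxx.
exists (phi m); split=> [|z zD pz|a ak].
- by rewrite setU1r ?h1.
- rewrite ltnNge; apply: contra top => kz; apply/exists_inP.
  have [yz|yz] := eqVneq (y z) k; first by exists z => //; rewrite pz yz !eqxx.
  have [|t [tD pt yt]] := h3 z k zD.
    by rewrite ltn_neqAle eq_sym (inj_eq val_inj) yz.
  by exists t => //; rewrite pt pz yt !eqxx.
- have [am|am] := eqVneq a a0; first by exists m; rewrite am.
  apply: h3 => //; rewrite ym ltn_neqAle (inj_eq val_inj) am /=.
  by rewrite -ltnS -kE.
Qed.

Definition tableau_of D (lam : 'I_n -> nat) :=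
  {q : {ffun X -> X} * word | tableau D q.1 q.2 /\ content D q.2 =1 lam}.

Definition tableau_tensor D lam (q : tableau_of D lam) : word -> K :=
  column_tensor K D (sval q).1 (sval q).2.

Lemma highest_sub D T T' :
  highest D T -> highest D T' -> highest D (fun w => T w - T' w).
Proof. by move=> hT hT' a b ab w; rewrite polarizeB hT // hT' // subrr. Qed.

(** The classification of the highest weight vectors of a tensor power, by
    induction on the number of slots. Sort the coefficients of the tensor by the
    letter in a slot [x]. For the greatest letter [k] that occurs there, the part
    with letter [k] is again a highest weight vector, in one slot less, hence a
    combination of column tensors. As the weight of the whole tensor is dominant,
    each of these has a column of height exactly [k] to receive a new box in the
    slot [x]. Subtracting the column tensors so obtained lowers [k]. *)
Lemma highest_weight_span D lam T :
  (forall v w, {in D, v =1 w} -> T v = T w) ->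
  (forall w, T w != 0 -> content D w =1 lam) ->
  highest D T -> in_span (@tableau_tensor D lam) T.
Proof.
move: {2}#|D| (erefl #|D|) => d; elim: d D lam T => [|d IHd] D lam T.
  move/cards0_eq=> -> TD Tlam _.
  have [[w0 Tw0]|T0] := pselect (exists w, T w != 0); last first.
    apply: in_span_ext (in_span0 _) => w; apply/esym/eqP/negPn/negP => Tw.
    by apply: T0; exists w.
  have q0 : tableau set0 [ffun x : X => x] w0 /\ content set0 w0 =1 lam.
    split; last exact: Tlam.
    by apply/tableauP; split=> [x|x z|x a]; rewrite inE.
  apply: in_span_ext (in_spanZ (T w0) (in_span_gen _ (exist _ (_, _) q0))) => w.
  rewrite (TD w w0) => [|x]; last by rewrite inE.
  rewrite /tableau_tensor /column_tensor (big_pred1 1%g) /= => [|s].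
    rewrite odd_perm1 mul1r (_ : [forall _ in _, _] = true) ?mulr1 //.
    by apply/forall_inP => x; rewrite inE.
  apply/column_permP/eqP => [[sD _]|->].
    by apply/permP => x; rewrite perm1 (out_perm sD) ?inE.
  by split=> [|x]; rewrite ?inE //; apply: perm_on1.
move=> cardD TD Tlam hT.
have /card_gt0P[x xD] : (0 < #|D|)%N by rewrite cardD.
pose D' := D :\ x; have DE : D = x |: D' by rewrite setD1K.
have xD' : x \notin D' by rewrite setD11.
have cardD' : #|D'| = d by apply: succn_inj; rewrite -cardD (cardsD1 x D) xD.
suff {T TD Tlam hT} H k T :
    (forall w (i : 'I_n), (k <= i)%N -> T (upd w x i) = 0) ->
    (forall v w, {in D, v =1 w} -> T v = T w) ->
    (forall w, T w != 0 -> content D w =1 lam) ->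
    highest D T -> in_span (@tableau_tensor D lam) T.
  by apply: (H n) => // w i ni; have := ltn_ord i; rewrite ltnNge ni.
elim: k T => [|k IHk] T Tk TD Tlam hT.
  apply: in_span_ext (in_span0 _) => w.
  by rewrite -(upd_same w x) Tk.
have [nk|kn] := leqP n k.
  apply: IHk => // w i ki; have := leq_trans (ltn_ord i) (leq_trans nk ki).
  by rewrite ltnn.
pose k' := Ordinal kn; pose Tx w := T (upd w x k').
have [[w0 Tw0]|Tx0] := pselect (exists w, Tx w != 0); last first.
  apply: IHk => // w i; rewrite leq_eqVlt => /predU1P[ki|/Tk//].
  have -> : i = k' by apply: val_inj.
  by apply/eqP/negPn/negP => Tw; apply: Tx0; exists w.
pose lam' a := (lam a - (k' == a))%N.
have lamE w a : Tx w != 0 -> lam a = ((k' == a) + content D' w a)%N.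
  by move=> /Tlam/(_ a) <-; rewrite DE content_upd.
have /IHd IH : #|D'| = d by [].
have {IH} [|||m [c [q TxE]]] := IH lam' Tx.
- move=> v w vw; apply: TD => z; rewrite DE => /setU1P[->|zD]; rewrite ?upd_id //.
  have zx : z != x by apply: contraNneq xD' => <-.
  by rewrite !upd_other // vw.
- by move=> w Tw a; rewrite /lam' (lamE w a Tw) addKn.
- move=> a b ab w; have := hT a b ab (upd w x k').
  rewrite /polarize DE big_mkcondr big_setU1 //= -big_mkcondr /=.
  rewrite upd_id (_ : (if _ then _ else _) = 0) ?add0r => [h|]; last first.
    by case: eqP => // k'a; rewrite upd_twice Tk // ab -k'a.
  rewrite -[RHS]h; apply: eq_big => [z|z /andP[zD _]].
    apply: andb_id2l => zD; rewrite upd_other //; by apply: contraNneq xD' => <-.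
  by rewrite /Tx updC //; apply: contraNneq xD' => <-.
(* The weight of [T] is dominant, and that of [Tx] has one letter [k] less. *)
have dom a : k' = a.+1 :> nat -> (lam' k' < lam' a)%N.
  move=> ka; have ak : k' == a = false.
    by apply/eqP => e; move/eqP: ka; rewrite -e (ltn_eqF (ltnSn _)).
  have : (lam k' <= lam a)%N.
    apply: (@highest_dominant K n X D a k' T) => //.
    - by rewrite eq_sym ak.
    - exact: hT.
    - by move=> w /Tlam h.
    - by exists (upd w0 x k').
  rewrite /lam' ak eqxx subn0 => h; apply: leq_trans h.
  by rewrite (lamE w0 k' Tw0) eqxx add1n subn1.
have ex_l j : exists l,
    [/\ l \in x |: D',
        forall z, z \in D' -> (sval (q j)).1 z = l -> ((sval (q j)).2 z < k')%N
      & forall a, (a < k')%N -> exists z,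
          [/\ z \in D', (sval (q j)).1 z = l & (sval (q j)).2 z = a]].
  have [tab cont] := svalP (q j); apply: exists_column => // a ka.
  by rewrite !cont dom.
have [l lP] := choice ex_l.
pose q' j := (set_column (sval (q j)).1 x (l j), upd (sval (q j)).2 x k').
have q'P j : tableau D (q' j).1 (q' j).2 /\ content D (q' j).2 =1 lam.
  have [l1 l2 l3] := lP j; move: (svalP (q j)) => [tab cont]; rewrite DE.
  split=> [|a]; first exact: tableau_new_box.
  rewrite content_upd // cont /lam' subnKC // (lamE w0 a Tw0); exact: leq_addr.
pose T' w := \sum_(j < m) c j * tableau_tensor (exist _ (q' j) (q'P j)) w.
have T'k w (i : 'I_n) : (k <= i)%N -> T' (upd w x i) = (i == k')%:R * Tx w.
  move=> ki; rewrite TxE mulr_sumr; apply: eq_bigr => j _.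
  have [l1 l2 l3] := lP j; have [tab _] := svalP (q j).
  rewrite /tableau_tensor /= DE column_tensor_new_box //.
  by rewrite mulrCA.
have T'span : in_span (@tableau_tensor D lam) T'.
  by apply: in_span_sum => j _; apply/in_spanZ/in_span_gen.
suff: in_span (@tableau_tensor D lam) (fun w => T w - T' w).
  move=> h; apply: in_span_ext (in_spanD h T'span) => w; exact: subrK.
have col_content j w :
    tableau_tensor (exist _ (q' j) (q'P j)) w != 0 -> content D w =1 lam.
  move=> /column_tensor_content h a; rewrite h; by have [_ ->] := q'P j.
apply: IHk.
- move=> w i; rewrite leq_eqVlt => /predU1P[ki|ki].
    have -> : i = k' by apply: val_inj.
    by rewrite T'k // eqxx mul1r subrr.
  rewrite T'k 1?ltnW // Tk // [i == k'](_ : _ = false) ?mul0r ?subr0 //.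
  by apply/eqP => e; rewrite e ltnn in ki.
- move=> v w vw; rewrite (TD v w) //; congr (_ - _).
  apply: eq_bigr => j _; congr (_ * _); apply: eq_bigr => s _; congr (_ * _%:R).
  congr nat_of_bool; apply: eq_forallb => z; apply: implyb_id2l => zD.
  by rewrite vw.
- move=> w; apply: contraNP => /existsNP[a /eqP ca].
  have [/eqP->|/Tlam/(_ a)/eqP] := boolP (T w == 0); last by rewrite (negbTE ca).
  rewrite sub0r oppr_eq0; apply/eqP; apply: big1 => j _.
  have [->|/col_content/(_ a)/eqP] :=
      eqVneq (tableau_tensor (exist _ (q' j) (q'P j)) w) 0.
    by rewrite mulr0.
  by rewrite (negbTE ca).
- apply: highest_sub => // a b ab w; rewrite polarize_sum big1 // => j _.
  rewrite column_tensor_highest ?mulr0 //; by have [] := q'P j.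
Qed.

End HighestWeightTensors.

(** * Tensors that are highest weight vectors on two sides *)

Section TensorOfSpans.
Variable K : fieldType.

Definition tab_mx (J I : finType) (g : J -> I -> K) : 'M[K]_(#|J|, #|I|) :=
  \matrix_(j, i) g (enum_val j) (enum_val i).

Lemma in_span_submx (W I J : finType) (e : I -> W -> K) (g : J -> W -> K) :
  (forall j, in_span e (g j)) -> (tab_mx g <= tab_mx e)%MS.
Proof.
move=> ge; apply/row_subP => j; have [m [c [x gE]]] := ge (enum_val j).
have -> : row j (tab_mx g) = \sum_(k < m) c k *: row (enum_rank (x k)) (tab_mx e).
  apply/rowP => w; rewrite !mxE gE summxE; apply: eq_bigr => k _.
  by rewrite !mxE enum_rankK.
by apply: summx_sub => k _; apply/scalemx_sub/row_sub.
Qed.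

(** With the generators as rows of matrices, the first condition factors [T]
    through the transpose of [tab_mx e], and by the second one
    [pinvmx (tab_mx g) *m tab_mx g] fixes [T]. The matrix [c] combines the two. *)
Lemma in_span_tensor (V W I J : finType) (e : I -> V -> K) (g : J -> W -> K)
    (T : V -> W -> K) :
  (forall w, in_span e (T^~ w)) -> (forall v, in_span g (T v)) ->
  exists c : I -> J -> K, forall v w,
    T v w = \sum_i \sum_j c i j * (e i v * g j w).
Proof.
move=> Te Tg.
have /submxP[A AE] : ((tab_mx T)^T <= tab_mx e)%MS.
  rewrite (_ : _^T = tab_mx (fun w v => T v w)); last first.
    by apply/matrixP => w v; rewrite !mxE.
  exact: in_span_submx.
have sTg : (tab_mx T <= tab_mx g)%MS by apply: in_span_submx.
pose C := A^T *m pinvmx (tab_mx g).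
have TE : tab_mx T = (tab_mx e)^T *m C *m tab_mx g.
  by rewrite -{1}(mulmxKpV sTg) -{1}[tab_mx T]trmxK AE trmx_mul !mulmxA.
exists (fun i j => C (enum_rank i) (enum_rank j)) => v w.
have := congr1 (fun M : 'M_(_, _) => M (enum_rank v) (enum_rank w)) TE.
rewrite [LHS]mxE !enum_rankK => ->; rewrite mxE exchange_big /=.
rewrite (reindex _ (onW_bij _ (@enum_rank_bij J))) /=; apply: eq_bigr => j _.
rewrite mxE big_distrl /= (reindex _ (onW_bij _ (@enum_rank_bij I))) /=.
by apply: eq_bigr => i _; rewrite !mxE !enum_rankK mulrAC mulrC.
Qed.

End TensorOfSpans.

Section FiniteGenerators.
Variables (K : numClosedFieldType) (n : nat) (X : finType).
Local Notation word := {ffun X -> 'I_n}.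

Definition full_tableau :=
  {q : {ffun X -> X} * word | tableau [set: X] q.1 q.2}.

Definition full_tensor (q : full_tableau) : word -> K :=
  column_tensor K [set: X] (sval q).1 (sval q).2.

(** A raising operator changes all weights by the same amount, so that each weight
    component of a highest weight vector is again a highest weight vector. *)
Lemma highest_span (T : word -> K) :
  highest [set: X] T -> in_span full_tensor T.
Proof.
move=> hT.
pose has_weight (w : word) (lam : {ffun 'I_n -> 'I_#|X|.+1}) :=
  [forall a, content [set: X] w a == lam a :> nat].
pose part lam w := if has_weight w lam then T w else 0.
have content_bound (w : word) a : (content [set: X] w a < #|X|.+1)%N.
  by rewrite ltnS; apply: max_card.
apply: (@in_span_ext _ _ _ _ (fun w => \sum_lam part lam w)).
  move=> w; rewrite (bigD1 [ffun a => Ordinal (content_bound w a)]) //= big1.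
    rewrite /part (_ : has_weight _ _ = true) ?addr0 //.
    by apply/forallP => a; rewrite ffunE.
  move=> lam lamw; rewrite /part ifN //; apply: contraNN lamw => /forallP h.
  by apply/eqP/ffunP => a; rewrite ffunE; apply/val_inj/esym/eqP/h.
apply: in_span_sum => lam _.
suff: in_span (@tableau_tensor K n X [set: X] (fun a => lam a)) (part lam).
  apply: in_span_trans => -[q [qt qc]].
  exact: (in_span_gen _ (exist _ q qt : full_tableau)).
apply: highest_weight_span.
- by move=> v w vw; congr part; apply/ffunP => x; apply: vw.
- move=> w; rewrite /part; case: ifP => [/forallP h _ a|_]; last by rewrite eqxx.
  exact/eqP/h.
move=> a b ab w.
have content_move x (c : 'I_n) : w x = a ->
    (content [set: X] (upd w x b) c + (a == c) = content [set: X] w c + (b == c))%N.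
  move=> wx; rewrite -(setD1K (in_setT x)) content_upd ?setD11 //.
  rewrite content_setU1 ?setD11 // wx; lia.
pose ok := [forall c, (content [set: X] w c + (b == c) == lam c + (a == c))%N].
have okE x : w x = a -> has_weight (upd w x b) lam = ok.
  move=> wx; apply: eq_forallb => c.
  by rewrite -(content_move x c wx) eqn_add2r.
case: (boolP ok) => okw; last first.
  rewrite /polarize big1 // => x /andP[_ /eqP wx].
  by rewrite /part okE // (negbTE okw).
rewrite -(hT a b ab w); apply: eq_bigr => x /andP[_ /eqP wx].
by rewrite /part okE // okw.
Qed.

End FiniteGenerators.

(** * Orthogonal projection of linear forms *)

Section Projection.
Variables (K : numClosedFieldType) (W : finType).
Implicit Types (T z : W -> K) (Y : (W -> K) -> Prop).

Definition conj_of Y (y : {z | Y z}) (w : W) : K := (sval y w)^*.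

(** Orthogonal projection onto the span of the conjugates of [Y]: a linear form
    keeps its values on [Y] when its coefficients are projected. *)
Lemma conj_span_projection Y T :
  exists2 T', in_span (@conj_of Y) T' &
    forall z, Y z -> \sum_w T' w * z w = \sum_w T w * z w.
Proof.
pose mx m (y : 'I_m -> {z | Y z}) : 'M[K]_(m, #|W|) :=
  \matrix_(k, w) sval (y k) (enum_val w).
pose P (r : nat) := `[< exists m (y : 'I_m -> {z | Y z}), \rank (mx m y) = r >].
(* Finitely many points of [Y] of maximal rank span all of [Y]. *)
have exP : exists r, P r.
  exists (\rank (mx 0 (fun i : 'I_0 => match notF (ltn_ord i) with end))).
  by apply/asboolP; exists 0; eexists.
have ubP r : P r -> (r <= #|W|)%N.
  by move=> /asboolP[m [y <-]]; apply: rank_leq_col.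
have [_ /asboolP[m [y <-]] max_rank] := ex_maxnP exP ubP.
have sub_y z : Y z -> (\row_w z (enum_val w) <= mx m y)%MS.
  move=> Yz; pose y' (k : 'I_(m + 1)) :=
    match split k with inl i => y i | inr _ => exist _ z Yz end.
  have y'E : mx _ y' = col_mx (mx m y) (\row_w z (enum_val w)).
    apply/matrixP => k w; rewrite !mxE /y'; case: splitP => i _; by rewrite !mxE.
  have /max_rank : P (\rank (mx _ y')) by apply/asboolP; exists (m + 1)%N, y'.
  rewrite y'E -addsmxE => rk; apply: submx_trans (addsmxSr (mx m y) _) _.
  by rewrite -mxrank_leqif_sup ?addsmxSl // eqn_leq rk mxrankS ?addsmxSl.
pose U := map_mx Num.conj (mx m y); pose t : 'rV[K]_#|W| := \row_w T (enum_val w).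
pose t' := t *m proj_ortho U.
have /submxP[c t'E] : (t' <= U)%MS by apply: proj_ortho_sub.
have orth k : \sum_w (t - t') 0 w * mx m y k w = 0.
  have /orthomx1P/matrixP/(_ 0 k) := proj_ortho_compl_sub U t.
  rewrite mxE [RHS]mxE => h; rewrite -[RHS]h; apply: eq_bigr => w _.
  by congr (_ * _); rewrite !mxE conjCK.
exists (fun w => t' 0 (enum_rank w)) => [|z Yz].
  exists m, (c 0), y => w; rewrite t'E mxE; apply: eq_bigr => k _.
  by rewrite !mxE enum_rankK.
have /submxP[d zE] := sub_y z Yz.
apply/esym/eqP; rewrite -subr_eq0 -sumrB; apply/eqP.
rewrite (reindex _ (onW_bij _ (@enum_val_bij W))) /=.
transitivity (\sum_w \sum_k d 0 k * ((t - t') 0 w * mx m y k w)).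
  apply: eq_bigr => w _; rewrite -mulrBl !enum_valK.
  have <- : (t - t') 0 w = T (enum_val w) - t' 0 w by rewrite !mxE.
  have -> : z (enum_val w) = (d *m mx m y) 0 w by rewrite -zE mxE.
  by rewrite [X in _ * X]mxE mulr_sumr; apply: eq_bigr => k _; rewrite mulrCA.
rewrite exchange_big big1 //= => k _; by rewrite -mulr_sumr orth mulr0.
Qed.

(** Such a tensor is orthogonal to itself. *)
Lemma conj_span_eq0 Y T : in_span (@conj_of Y) T ->
  (forall z, Y z -> \sum_w T w * z w = 0) -> forall w, T w = 0.
Proof.
move=> [m [c [y TE]]] T0 w0; apply/eqP; rewrite -mul_conjC_eq0.
have : \sum_w T w * (T w)^* = 0.
  transitivity (\sum_w \sum_k (c k)^* * (T w * sval (y k) w)).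
    apply: eq_bigr => w _; rewrite {2}TE rmorph_sum mulr_sumr.
    by apply: eq_bigr => k _; rewrite rmorphM /= conjCK mulrCA.
  rewrite exchange_big big1 //= => k _.
  by rewrite -mulr_sumr T0 ?mulr0 //; apply: svalP.
move/eqP; rewrite psumr_eq0 => [/allP/(_ w0)|w _]; last exact: mul_conjC_ge0.
by rewrite mem_index_enum => /(_ isT).
Qed.

End Projection.

(** * Forms *)

Section Homogeneous.
Variables (K : comNzRingType) (I : eqType).
Implicit Types (F G : (I -> K) -> K) (Z : I -> K) (r s e m : nat).

(** A form of degree [r] in the indeterminates indexed by [I], seen as a
    polynomial function. *)
Definition homogeneous r F := exists2 l : seq (K * seq I),
  all (fun t => size t.2 == r) l &
  forall Z, F Z = \sum_(t <- l) t.1 * \prod_(i <- t.2) Z i.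

Lemma homogeneous_ext r F G : F =1 G -> homogeneous r F -> homogeneous r G.
Proof. by move=> FG [l lr FE]; exists l => // Z; rewrite -FG. Qed.

Lemma homogeneous0 r : homogeneous r (fun=> 0).
Proof. by exists [::] => // Z; rewrite big_nil. Qed.

Lemma homogeneous_const a : homogeneous 0 (fun=> a).
Proof.
by exists [:: (a, [::])] => // Z; rewrite big_seq1 big_nil mulr1.
Qed.

Lemma homogeneous_var i : homogeneous 1 (fun Z => Z i).
Proof. by exists [:: (1, [:: i])] => // Z; rewrite !big_seq1 mul1r. Qed.

Lemma homogeneousD r F G :
  homogeneous r F -> homogeneous r G -> homogeneous r (fun Z => F Z + G Z).
Proof.
move=> [l lr FE] [l' lr' GE]; exists (l ++ l'); first by rewrite all_cat lr.
by move=> Z; rewrite big_cat FE GE.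
Qed.

Lemma homogeneousM r s F G :
  homogeneous r F -> homogeneous s G -> homogeneous (r + s) (fun Z => F Z * G Z).
Proof.
move=> [l lr FE] [l' ls GE].
exists [seq (t.1 * t'.1, t.2 ++ t'.2) | t <- l, t' <- l'].
  apply/allP => _ /allpairsP[[t t'] [/= tl tl' ->]] /=.
  by rewrite size_cat (eqP (allP lr t tl)) (eqP (allP ls t' tl')).
move=> Z; rewrite big_allpairs_dep FE GE mulr_suml; apply: eq_bigr => t _.
rewrite mulr_sumr; apply: eq_bigr => t' _.
by rewrite /= big_cat mulrACA.
Qed.

Lemma homogeneousZ r a F : homogeneous r F -> homogeneous r (fun Z => a * F Z).
Proof. by move=> rF; apply: (homogeneousM (homogeneous_const a) rF). Qed.

Lemma homogeneous_sum (J : Type) (l : seq J) (P : pred J) r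
    (F_ : J -> (I -> K) -> K) :
  (forall j : J, P j -> homogeneous r (F_ j)) ->
  homogeneous r (fun Z => \sum_(j <- l | P j) F_ j Z).
Proof.
move=> rF; elim: l => [|j l IHl].
  by apply: homogeneous_ext (homogeneous0 r) => Z; rewrite big_nil.
case Pj: (P j); last by apply: homogeneous_ext IHl => Z; rewrite big_cons Pj.
by apply: homogeneous_ext (homogeneousD (rF j Pj) IHl) => Z; rewrite big_cons Pj.
Qed.

Lemma homogeneous_prod (J : Type) (l : seq J) (e : J -> nat)
    (F_ : J -> (I -> K) -> K) :
  (forall j : J, homogeneous (e j) (F_ j)) ->
  homogeneous (\sum_(j <- l) e j) (fun Z => \prod_(j <- l) F_ j Z).
Proof.
move=> rF; elim: l => [|j l IHl].
  rewrite big_nil; apply: homogeneous_ext (homogeneous_const 1) => Z.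
  by rewrite big_nil.
rewrite big_cons; apply: homogeneous_ext (homogeneousM (rF j) IHl) => Z.
by rewrite big_cons.
Qed.

Lemma homogeneousX r F k :
  homogeneous r F -> homogeneous (k * r) (fun Z => F Z ^+ k).
Proof.
move=> rF; elim: k => [|k IHk]; first exact: homogeneous_const.
by rewrite mulSn; apply: homogeneous_ext (homogeneousM rF IHk) => Z; rewrite exprS.
Qed.

Lemma homogeneous_det m r (A : (I -> K) -> 'M[K]_m) :
  (forall i j, homogeneous r (fun Z => A Z i j)) ->
  homogeneous (m * r) (fun Z => \det (A Z)).
Proof.
move=> rA; rewrite /determinant; apply: homogeneous_sum => s _.
apply: homogeneousZ; rewrite -[m in (m * r)%N]card_ord -sum_nat_const.
exact: homogeneous_prod.
Qed.

Lemma homogeneous_adj m r (A : (I -> K) -> 'M[K]_m) :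
  (forall i j, homogeneous r (fun Z => A Z i j)) ->
  forall i j, homogeneous (m.-1 * r) (fun Z => (\adj (A Z)) i j).
Proof.
move=> rA i j.
apply: (@homogeneous_ext _ (fun Z => (-1) ^+ (j + i) * \det (row' j (col' i (A Z))))).
  by move=> Z; rewrite mxE.
apply/homogeneousZ/homogeneous_det => i' j'.
by apply: homogeneous_ext (rA (lift j i') (lift i j')) => Z; rewrite !mxE.
Qed.

End Homogeneous.

(** * Invariant tensors *)

Section InvariantTensors.
Variables (K : numClosedFieldType) (J X : finType).
Local Notation word := {ffun X -> J}.
Implicit Types (f : word) (T : word -> K) (Z : J -> K) (D : J -> J -> K) (s : K).

Definition monomial Z f : K := \prod_x Z (f x).

Definition form_of T Z : K := \sum_f T f * monomial Z f.

(** The linear substitution [1 + s D] of the indeterminates. *)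
Definition shear s D Z j : K := Z j + s * \sum_k D j k * Z k.

Definition adjoint D j k : K := (D k j)^*.

Definition shear_coef s D j k : K := (j == k)%:R + s * D j k.

Lemma shearE s D Z j : shear s D Z j = \sum_k shear_coef s D j k * Z k.
Proof.
rewrite /shear_coef; under eq_bigr do rewrite mulrDl.
rewrite big_split /= (bigD1 j) //= eqxx mul1r big1 ?addr0 => [|k /negbTE kj].
  by congr (_ + _); rewrite mulr_sumr; apply: eq_bigr => k _; rewrite mulrA.
by rewrite eq_sym kj mul0r.
Qed.

Lemma monomial_shear s D Z f :
  monomial (shear s D Z) f =
  \sum_(f' : word) (\prod_x shear_coef s D (f x) (f' x)) * monomial Z f'.
Proof.
rewrite /monomial; under eq_bigr do rewrite shearE.
rewrite bigA_distr_bigA /=; apply: eq_bigr => f' _.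
by rewrite big_split.
Qed.

Definition shear_tensor s D T f' : K :=
  \sum_f T f * \prod_x shear_coef s D (f x) (f' x).

Lemma form_of_shear s D T Z :
  form_of (shear_tensor s D T) Z = form_of T (shear s D Z).
Proof.
rewrite /form_of /shear_tensor; under eq_bigr do rewrite mulr_suml.
rewrite exchange_big /=; apply: eq_bigr => f _.
by rewrite monomial_shear mulr_sumr; apply: eq_bigr => f' _; rewrite mulrA.
Qed.

Lemma conj_monomial_shear s D Z f' :
  shear_tensor s D (fun f => (monomial Z f)^*) f' =
  (monomial (shear s^* (adjoint D) Z) f')^*.
Proof.
rewrite monomial_shear rmorph_sum; apply: eq_bigr => f _.
rewrite rmorphM mulrC; congr (_ * _); rewrite rmorph_prod.
apply: eq_bigr => x _; rewrite /shear_coef /adjoint rmorphD rmorphM /= !conjCK conjC_nat.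
by rewrite eq_sym.
Qed.

(** A constant polynomial function over an infinite field is a constant
    polynomial. *)
Lemma poly_const_coef1 (m : nat) (c : 'I_m -> K) (e : 'I_m -> nat) (a : K) :
  (forall s, \sum_(i < m) c i * s ^+ e i = a) -> \sum_(i < m | e i == 1%N) c i = 0.
Proof.
move=> h; pose q : {poly K} := \sum_(i < m) c i *: 'X^(e i) - a%:P.
have q0 : q = 0.
  apply: (@roots_geq_poly_eq0 _ _ [seq i%:R | i <- iota 0 (size q)]).
  - apply/allP => _ /mapP[i _ ->]; apply/rootP.
    rewrite hornerD hornerN hornerC horner_sum.
    by under eq_bigr do rewrite hornerZ hornerXn; rewrite h subrr.
  - rewrite map_inj_uniq ?iota_uniq // => i j /eqP; by rewrite eqr_nat => /eqP.
  - by rewrite size_map size_iota.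
have := congr1 (fun q : {poly K} => q`_1) q0.
rewrite coef0 coefB coefC /= subr0 coef_sum => q1.
rewrite -[RHS]q1 big_mkcond; apply: eq_bigr => i _ /=; rewrite coefZ coefXn eq_sym.
by case: eqP; rewrite ?mulr1 ?mulr0.
Qed.

(** The coefficient of [s] in a polynomial identity in [s]. A word contributes to
    it only if it differs from [f'] in at most one slot. *)
Lemma shear_tensor_inv_lie D T f' :
  (forall s, shear_tensor s D T f' = T f') ->
  \sum_x \sum_j D j (f' x) * T (upd f' x j) = 0.
Proof.
move=> inv.
pose c (S : {set X}) := \sum_f T f * \prod_x
  (if x \in S then D (f x) (f' x) else (f x == f' x)%:R).
have expand s : \sum_(S : {set X}) c S * s ^+ #|S| = T f'.
  rewrite -(inv s) /shear_tensor /c; under eq_bigr do rewrite mulr_suml.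
  rewrite exchange_big /=; apply: eq_bigr => f _.
  under eq_bigr do rewrite -mulrA; rewrite -mulr_sumr; congr (_ * _).
  under [RHS]eq_bigr do rewrite /shear_coef addrC.
  rewrite bigA_distr /=; apply: eq_bigr => S _.
  rewrite -[s ^+ _]prodr_const [X in _ * X]big_mkcond -big_split /=.
  apply: eq_bigr => x _.
  by case: ifP; rewrite ?mulr1 // mulrC.
have : \sum_(S : {set X} | #|S| == 1%N) c S = 0.
  pose V (i : 'I_#|{set X}|) : {set X} := enum_val i.
  rewrite (reindex _ (onW_bij _ (@enum_val_bij {set X}))) /=.
  apply: (poly_const_coef1 (c := fun i => c (V i)) (e := fun i => #|V i|)
    (a := T f')) => s.
  by rewrite -(expand s) [RHS](reindex _ (onW_bij _ (@enum_val_bij {set X}))).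
rewrite (eq_bigl (fun S => S \in [set [set x] | x : X])); last first.
  move=> S; apply/cards1P/imsetP => [[x ->]|[x _ ->]]; first by exists x.
  by exists x.
rewrite big_imset /=; last by move=> x y _ _; apply: set1_inj.
move=> h; rewrite -[RHS]h; apply: eq_bigr => x _; apply/esym.
rewrite /c (bigID (fun f => f == upd f' x (f x))) /= addrC big1 ?add0r.
  rewrite (reindex_onto (fun j => upd f' x j) (fun f => f x)) /=; last first.
    by move=> f /eqP <-.
  apply: eq_big => [j|j _]; first by rewrite upd_id !eqxx.
  rewrite mulrC; congr (_ * _); rewrite (bigD1 x) //= set11 upd_id.
  rewrite big1 ?mulr1 // => z zx.
  by rewrite inE (negbTE zx) upd_other // eqxx.
move=> f ff'; have [z zx fz] : exists2 z, z != x & f z != f' z.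
  apply/exists_inP; apply: contraR ff'; rewrite negb_exists_in => /forall_inP ff'.
  apply/eqP/ffunP => z; rewrite updE; case: eqVneq => [->//|zx].
  by apply/eqP/negPn/ff'.
by rewrite (bigD1 z) //= inE (negbTE zx) (negbTE fz) mul0r mulr0.
Qed.

(** The tensor of coefficients of a form on an invariant set [Y] may be chosen
    to be itself invariant: among the tensors with given values on [Y] there is
    only one in the span of the conjugates of the points of [Y], and that span is
    stable because [Y] is stable under adjoints. *)
Lemma invariant_tensor (Y : (J -> K) -> Prop) T :
  exists2 T', forall Z, Y Z -> form_of T' Z = form_of T Z &
    forall D,
      (forall s Z, Y Z -> Y (shear s D Z) /\ Y (shear s (adjoint D) Z)) ->
      (forall s Z, Y Z -> form_of T (shear s D Z) = form_of T Z) ->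
      forall f, \sum_x \sum_j D j (f x) * T' (upd f x j) = 0.
Proof.
pose powers (z : word -> K) := exists2 Z, Y Z & z = monomial Z.
have [T' T'span T'E] := conj_span_projection powers T.
have T'Y Z : Y Z -> form_of T' Z = form_of T Z.
  by move=> YZ; apply: T'E; exists Z.
exists T' => // D stab inv f; apply: shear_tensor_inv_lie => s.
apply/eqP; rewrite -subr_eq0; apply/eqP; move: f.
apply: (@conj_span_eq0 _ _ powers); last first.
  move=> _ [Z YZ ->]; under eq_bigr do rewrite mulrBl.
  rewrite sumrB -!/(form_of _ _) form_of_shear T'Y; last by case: (stab s Z YZ).
  by rewrite inv // -T'Y // subrr.
apply: in_span_ext (in_spanD _ (in_spanZ (-1) T'span)) => [f|].
  by rewrite mulN1r.
have [m [c [z T'c]]] := T'span.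
apply: (@in_span_ext _ _ _ _ (fun f => \sum_(k < m) c k *
    shear_tensor s D (fun f => (sval (z k) f)^*) f)).
  move=> f; rewrite /shear_tensor; under [RHS]eq_bigr do rewrite T'c mulr_suml.
  rewrite [RHS]exchange_big /=; apply: eq_bigr => k _.
  by rewrite mulr_sumr; apply: eq_bigr => g _; rewrite mulrA.
apply: in_span_sum => k _; apply: in_spanZ.
have [Z YZ zE] := svalP (z k).
have YsZ : powers (monomial (shear s^* (adjoint D) Z)).
  by exists (shear s^* (adjoint D) Z) => //; case: (stab s^* Z YZ).
apply: in_span_ext (in_span_gen _ (exist _ _ YsZ)) => f.
by rewrite /conj_of /= zE conj_monomial_shear.
Qed.

End InvariantTensors.

(** * Contractions as sums of determinants *)

(** Ryser's formula, an inclusion-exclusion over the set of values of a map: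
    it expresses a permanent as a combination of products of row sums. *)
Lemma ryser (K : comNzRingType) (X : finType) (F : X -> X -> K) :
  \sum_(S : {set X}) (-1) ^+ #|~: S| * \prod_x \sum_(m in S) F x m =
  \sum_(s : {perm X}) \prod_x F x (s x).
Proof.
under eq_bigr do rewrite bigA_distr_big mulr_sumr.
rewrite (exchange_big_dep xpredT) //=.
have incl_excl (f : {ffun X -> X}) :
    \sum_(S : {set X} | f \in ffun_on (mem S)) (-1) ^+ #|~: S| = (injectiveb f)%:R :> K.
  pose im := [set f x | x : X].
  transitivity (\sum_(S in {set X})
      \prod_x (if x \in S then 1 else - (x \notin im)%:R : K)).
    rewrite big_mkcond; apply: eq_bigr => S _ /=; case: ffun_onP => fS.
      rewrite -prodr_const big_mkcond; apply: eq_bigr => x _; rewrite in_setC.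
      case: (boolP (x \in S)) => //= xS; rewrite (_ : x \in im = false) //.
      by apply: contraNF xS => /imsetP[z _ ->]; apply: fS.
    have [z zS] : exists z, f z \notin S.
      apply/existsP; apply/contra_notT: fS; rewrite negb_exists => /forallP h z.
      by have /negbNE := h z.
    by rewrite (bigD1 (f z)) //= (negbTE zS) imset_f // oppr0 mul0r.
  rewrite -bigA_distr; have [fi|fi] := boolP (injectiveb f).
    rewrite big1 // => x _; have /injectiveP/injF_bij[g fg gf] := fi.
    by rewrite -(gf x) imset_f //= oppr0 addr0.
  have [x xim] : exists x, x \notin im.
    apply/existsP; apply: contraR fi; rewrite negb_exists => /forallP h.
    have /imset_injP inj_f : #|im| == #|X|.
      by apply/eqP/eq_card => x; have /negbNE := h x.
    by apply/injectiveP => x z; apply: inj_f.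
  by rewrite (bigD1 x) //= xim subrr mul0r.
under eq_bigr do rewrite -mulr_suml incl_excl.
rewrite (bigID (fun f : {ffun X -> X} => injectiveb f)) /=.
rewrite [X in _ + X]big1 ?addr0; last first.
  by move=> f /negbTE->; rewrite mul0r.
rewrite (reindex (@pval X)) /=; last first.
  pose s0 : {perm X} := 1%g.
  exists (insubd s0) => /= f fi.
    by apply: val_inj; rewrite val_insubd (valP f).
  by rewrite -[LHS]/(val (insubd s0 f)) insubdK.
apply: eq_big => [s|s _]; first by rewrite (valP s).
by rewrite (valP s) mul1r; apply: eq_bigr => x _; rewrite pvalE.
Qed.

Section Pairing.
Variables (K : numClosedFieldType) (n r : nat).
Local Notation X := 'I_r.
Local Notation word := {ffun X -> 'I_n.+1}.
Local Notation filling := ({ffun X -> X} * word)%type.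
Local Notation letter := ('I_n.+1 * 'I_n.+1 * bool)%type.
Implicit Types (A B : filling) (S : {set X}) (c : {ffun X -> bool}).
Implicit Types (Z : letter -> K).

(** The block matrix attached to a pair of tableaux: its rows are the boxes of
    [A], its columns the boxes of [B], and its blocks are indexed by a column of
    [A] and a column of [B]. The block is the sum of the matrices [Z (_, _, c m)]
    over the slots [m] of [S] that lie in both columns. The rows are numbered
    from the last one. *)
Definition box_mx A B c S Z : 'M[K]_r :=
  \matrix_(x, x') \sum_(m in S)
    if (A.1 m == A.1 x) && (B.1 m == B.1 x')
    then Z (rev_ord (A.2 x), B.2 x', c m) else 0.

Lemma column_permT (phi : {ffun X -> X}) (s : {perm X}) :
  column_perm [set: X] phi s = [forall x, phi (s x) == phi x].
Proof.
rewrite /column_perm (_ : perm_on _ _) /=; last by apply/subsetP => x; rewrite !inE.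
by apply: eq_forallb => x; rewrite in_setT.
Qed.

Lemma sum_column_tensor A (G : word -> K) :
  \sum_v column_tensor K [set: X] A.1 A.2 v * G v =
  \sum_(s | column_perm [set: X] A.1 s) (-1) ^+ s * G [ffun x => A.2 (s x)].
Proof.
under eq_bigr do rewrite mulr_suml.
rewrite exchange_big /=; apply: eq_bigr => s _.
rewrite (bigD1 [ffun x => A.2 (s x)]) //= big1 ?addr0 => [|v vs].
  rewrite (_ : [forall _ in _, _] = true) ?mulr1 //.
  by apply/forall_inP => x _; rewrite ffunE.
rewrite (_ : [forall _ in _, _] = false) ?mulr0 ?mul0r //.
apply: contraNF vs => /forall_inP h; apply/eqP/ffunP => x.
by rewrite ffunE; apply/eqP/h; rewrite in_setT.
Qed.

(** The contraction is a sum over pairs of permutations [s], [t] preserving the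
    columns of [A] and of [B]. View [s^-1] as the map that sends a row box to the
    slot it is matched with, and [s^-1 * t] as the permutation of a term in the
    expansion of a determinant: the sum over [s] becomes a permanent, to which
    Ryser's formula applies. *)
Lemma pairing_sum_det A B c Z :
  \sum_v \sum_w column_tensor K [set: X] A.1 A.2 v *
      (column_tensor K [set: X] B.1 B.2 w * \prod_x Z (rev_ord (v x), w x, c x)) =
  \sum_(S : {set X}) (-1) ^+ #|~: S| * \det (box_mx A B c S Z).
Proof.
pose a (t : {perm X}) x m :=
  if (A.1 m == A.1 x) && (B.1 m == B.1 (t x))
  then Z (rev_ord (A.2 x), B.2 (t x), c m) else 0.
transitivity (\sum_(s : {perm X}) \sum_(t : {perm X})
    (-1) ^+ t * \prod_x a t x (s x)); last first.
  rewrite exchange_big /=.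
  transitivity (\sum_(t : {perm X}) (-1) ^+ t *
      \sum_(S : {set X}) (-1) ^+ #|~: S| * \prod_x \sum_(m in S) a t x m).
    by apply: eq_bigr => t _; rewrite ryser mulr_sumr.
  under eq_bigr do rewrite mulr_sumr.
  rewrite exchange_big /=; apply: eq_bigr => S _.
  rewrite /determinant mulr_sumr; apply: eq_bigr => t _.
  rewrite mulrCA; congr (_ * (_ * _)); apply: eq_bigr => x _.
  by rewrite mxE.
under eq_bigr do rewrite -mulr_sumr.
rewrite sum_column_tensor [RHS](reindex_inj invg_inj) big_mkcond /=.
apply: eq_bigr => s _; rewrite [RHS](reindex_inj (mulgI (s^-1)%g)) /=.
have prodE (t : {perm X}) : \prod_x a (s^-1 * t)%g x ((s^-1)%g x) =
    if column_perm [set: X] A.1 s && column_perm [set: X] B.1 t then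
      \prod_x Z (rev_ord (A.2 (s x)), B.2 (t x), c x) else 0.
  rewrite (reindex_inj (@perm_inj _ s)) /= /a.
  under eq_bigr do rewrite permK permM permK.
  rewrite !column_permT; case: andP => [[/forallP sA /forallP tB]|h].
    by apply: eq_bigr => x _; rewrite eq_sym sA eq_sym tB.
  have [x hx] : exists x, ~~ ((A.1 x == A.1 (s x)) && (B.1 x == B.1 (t x))).
    apply/existsP; apply/contra_notT: h; rewrite negb_exists => /forallP h.
    split; apply/forallP => x; have := h x; rewrite negbK => /andP[];
    by rewrite ![_ x == _]eq_sym.
  by rewrite (bigD1 x) //= (negbTE hx) mul0r.
under [RHS]eq_bigr do rewrite prodE.
case: ifP => [sA|_]; last by rewrite big1 // => t _; rewrite mulr0.
rewrite sum_column_tensor mulr_sumr big_mkcond; apply: eq_bigr => t _ /=.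
case: ifP => _; last by rewrite mulr0.
rewrite mulrA -signr_addb odd_permM odd_permV; congr (_ * _).
by apply: eq_bigr => x _; rewrite !ffunE.
Qed.
End Pairing.

(** * Determinants of blocks as functions of data *)

Section BoxMatrixIsDatum.
Variables (K : numClosedFieldType) (n r : nat).
Hypothesis r_gt0 : (0 < r)%N.
Local Notation X := 'I_r.
Local Notation letter := ('I_n.+1 * 'I_n.+1 * bool)%type.

(** A pair of matrices, seen as a point of the space with coordinates indexed by
    [letter]. *)
Definition pencil (g M : 'M[K]_n.+1) (j : letter) : K :=
  (if j.2 then M else g) j.1.1 j.1.2.

Lemma det_reindex (q : nat) (f g : 'I_q -> X) :
  q = r -> injective f -> injective g ->
  exists b : bool, forall M : 'M[K]_r,
    \det (\matrix_(i, j) M (f i) (g j)) = (-1) ^+ b * \det M.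
Proof.
move=> qr; subst q => inj_f inj_g.
exists (odd_perm (perm inj_f) (+) odd_perm (perm inj_g)) => M.
have -> : \matrix_(i, j) M (f i) (g j) =
    row_perm (perm inj_f) (col_perm (perm inj_g) M).
  by apply/matrixP => i j; rewrite !mxE !permE.
rewrite row_permE col_permE !det_mulmx !det_perm odd_permV signr_addb.
by rewrite [\det M * _]mulrC mulrA.
Qed.

Section ColumnsOfTableau.
Variable A : full_tableau n.+1 X.
Local Notation phi := (sval A).1.
Local Notation y := (sval A).2.

Definition columns := [set phi x | x : X].

Definition column_of (i : 'I_#|columns|) : X := enum_val i.

Definition column_size (i : 'I_#|columns|) := #|[set x | phi x == column_of i]|.

Lemma columns_gt0 : (0 < #|columns|)%N.
Proof. by apply/card_gt0P; exists (phi (Ordinal r_gt0)); apply: imset_f. Qed.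

Lemma height_inj x z : phi x = phi z -> y x = y z -> x = z.
Proof. by case/tableauP: (svalP A) => _ h _; apply: h; rewrite in_setT. Qed.

Lemma column_size_bound i : (1 <= column_size i <= n.+1)%N.
Proof.
apply/andP; split.
  have /imsetP[x _ xi] := enum_valP i.
  by apply/card_gt0P; exists x; rewrite inE -xi.
rewrite /column_size -(card_in_imset (f := y)).
  by rewrite -[n.+1 in leqRHS]card_ord max_card.
move=> x z; rewrite !inE => /eqP px /eqP pz; apply: height_inj.
by rewrite px pz.
Qed.

Lemma sum_column_size : (\sum_i column_size i)%N = r.
Proof.
transitivity #|X|; last exact: card_ord.
rewrite -[RHS]sum1_card [RHS](partition_big phi (mem columns)) /=; last first.
  by move=> x _; apply: imset_f.
rewrite [RHS]big_enum_val /=; apply: eq_bigr => i _.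
by rewrite /column_size -sum1_card; apply: eq_bigl => x; rewrite inE.
Qed.

(** The heights that occur in a column are closed downwards and as many as its
    boxes, hence they are all the numbers below its size. *)
Lemma box_exists i (h : nat) : (h < column_size i)%N ->
  exists x, phi x = column_of i /\ y x = h :> nat.
Proof.
move=> hi; have [//|no_box] :=
  pselect (exists x, phi x = column_of i /\ y x = h :> nat).
suff: (column_size i <= h)%N by rewrite leqNgt hi.
have low x : phi x = column_of i -> (y x < h)%N.
  move=> px; rewrite ltnNge leq_eqVlt; apply/negP => /predU1P[hx|hx].
    by apply: no_box; exists x.
  have [_ _ down] := tableauP _ _ _ (svalP A).
  have [//|z [_ pz yz]] :=
    down x (Ordinal (ltn_trans hx (ltn_ord (y x)))) (in_setT x).
  by apply: no_box; exists z; rewrite pz yz.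
rewrite /column_size cardE -(size_map (fun x => y x : nat)) -[leqRHS](size_iota 0).
apply: uniq_leq_size.
  rewrite map_inj_in_uniq ?enum_uniq // => x z; rewrite !mem_enum !inE.
  by move=> /eqP px /eqP pz /val_inj; apply: height_inj; rewrite px.
move=> _ /mapP[x + ->]; rewrite mem_enum inE mem_iota => /eqP/low.
by [].
Qed.

Lemma column_of_inj : injective column_of.
Proof. exact: enum_val_inj. Qed.

(** The numbering [h] of the boxes of a column of size [a] is a parameter because
    corners consist of the last rows, but of the first columns. *)
Lemma box_enumeration (h : nat -> nat -> nat) :
  (forall a k, (k < a)%N -> (h a k < a)%N) ->
  (forall a, {in gtn a &, injective (h a)}) ->
  exists2 f : 'I_(\sum_i column_size i) -> X, injective f &
    forall s, phi (f s) = column_of (tagnat.sig1 s) /\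
      y (f s) = h (column_size (tagnat.sig1 s)) (tagnat.sig2 s) :> nat.
Proof.
move=> h_lt h_inj.
have [f fP] := choice (fun s : 'I_(\sum_i column_size i) =>
  box_exists (h_lt _ _ (ltn_ord (tagnat.sig2 s)))).
exists f => // s t fst.
have [ps ys] := fP s; have [pt yt] := fP t.
have e1 : tagnat.sig1 s = tagnat.sig1 t by apply: column_of_inj; rewrite -ps -pt fst.
apply: val_inj; apply/eqP; rewrite -(tagnat.sig2K s) -(tagnat.sig2K t).
rewrite tagnat.eq_Rank; apply/andP; split; apply/eqP => //.
have e2 := congr1 column_size e1.
apply: (h_inj (column_size (tagnat.sig1 t))).
- by rewrite inE -e2.
- by rewrite inE.
- by rewrite -yt -fst ys; congr h.
Qed.

End ColumnsOfTableau.

(** The two matrices have the same entries up to the order of their rows and of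
    their columns: at [(1, N)] a slot of color [c m] contributes the power [N ^+ c m]
    to its block. *)
Lemma box_mx_datum (A B : full_tableau n.+1 X) (c : {ffun X -> bool}) (S : {set X}) :
  exists (P : datum K n) (b : bool), forall N,
    \det (box_mx (sval A) (sval B) c S (pencil 1 N)) =
    (-1) ^+ b * \det (datum_mx P N).
Proof.
have sizes : (\sum_i column_size (A := A) i = \sum_j column_size (A := B) j)%N.
  by rewrite !sum_column_size.
pose P := Datum (columns_gt0 A) (columns_gt0 B) (@column_size_bound A)
  (@column_size_bound B) sizes (fun i j =>
    \sum_(m in S | ((sval A).1 m == column_of i) &&
                   ((sval B).1 m == column_of j)) 'X^(c m)) : datum K n.
(* Rows are numbered downwards, whereas the heights of boxes grow upwards. *)
have [|a k k' /=|f inj_f fP] := @box_enumeration A (fun a k => a.-1 - k)%N.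
- by move=> a k; lia.
- by rewrite !inE; lia.
have [//|a k k' _ _ //|g inj_g gP] := @box_enumeration B (fun a k => k).
pose g' s := g (cast_ord sizes s).
have inj_g' : injective g' by move=> s t /inj_g/cast_ord_inj.
pose M N := box_mx (sval A) (sval B) c S (pencil 1 N).
have entries N : datum_mx P N = \matrix_(i, j) M N (f i) (g' j).
  apply/matrixP => i j; rewrite castmxE /= cast_ord_id !mxE.
  rewrite esymK; set j' := cast_ord _ j.
  have -> : g' j = g j' by [].
  have [pf yf] := fP i; have [pg yg] := gP j'.
  rewrite rmorph_sum summxE big_mkcondr; apply: eq_bigr => m mS.
  rewrite pf pg; case: ifP => // _.
  rewrite rmorphXn /= horner_mx_X /pencil /=.
  have -> : inord (n.+1 - column_size (tagnat.sig1 i) + tagnat.sig2 i) =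
      rev_ord ((sval A).2 (f i)).
    have ka : (tagnat.sig2 i < column_size (tagnat.sig1 i))%N := ltn_ord _.
    have /andP[a1 an] := column_size_bound (tagnat.sig1 i).
    apply: val_inj; rewrite /= yf; move: ka a1 an.
    move: (column_size _) (nat_of_ord (tagnat.sig2 i)) => a k ka a1 an.
    by rewrite inordK; lia.
  have -> : inord (tagnat.sig2 j') = (sval B).2 (g j').
    by apply: val_inj; rewrite /= -yg inord_val.
  by case: (c m).
have [b bE] := det_reindex (sum_column_size A) inj_f inj_g'.
exists P, b => N.
by rewrite entries bE mulrA -signr_addb addbb mul1r.
Qed.

End BoxMatrixIsDatum.

(** * Transfer from the cone to pairs of matrices *)

Section HardDirection.
Variables (K : numClosedFieldType) (n : nat).
Local Notation letter := ('I_n.+1 * 'I_n.+1 * bool)%type.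
Implicit Types (g M N u : 'M[K]_n.+1) (Z : letter -> K).

Lemma homogeneous_form_of (J : finType) (j0 : J) r (F : (J -> K) -> K) :
  homogeneous r F -> exists T : {ffun 'I_r -> J} -> K, F =1 form_of T.
Proof.
move=> [l lr FE]; pose word_of (s : seq J) := [ffun x : 'I_r => nth j0 s x].
exists (fun f => \sum_(t <- l | word_of t.2 == f) t.1) => Z.
rewrite FE /form_of; under [RHS]eq_bigr do rewrite mulr_suml.
rewrite (exchange_big_dep xpredT) //= big_seq [RHS]big_seq.
apply: eq_bigr => t /(allP lr)/eqP tr.
rewrite (big_pred1 (word_of t.2)) => [|f]; last by rewrite eq_sym.
congr (_ * _); rewrite (big_nth j0) tr big_mkord.
by apply: eq_bigr => x _; rewrite ffunE.
Qed.

Definition lhs_mx Z : 'M[K]_n.+1 := \matrix_(i, j) Z (i, j, false).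
Definition rhs_mx Z : 'M[K]_n.+1 := \matrix_(i, j) Z (i, j, true).

Definition eval_mx (p : {mpoly K[n.+1 * n.+1]}) M : K :=
  p.@[fun k => mxvec M 0 k].

(** As [g^-1] is [\adj g] divided by [\det g], a monomial of degree [e <= d] of [p]
    becomes [\det g ^+ (d - e)] times a monomial of degree [e] in the entries of
    [\adj g *m M], which are forms of degree [n.+1]. *)
Lemma clear_denominators p : exists2 d, (0 < d)%N &
  exists2 F, homogeneous (n.+1 * d) F &
    forall g M, g \in unitmx ->
      F (pencil g M) = \det g ^+ d * eval_mx p (g^-1 * M).
Proof.
exists (msize p).+1 => //; set d := (msize p).+1.
pose C Z := \adj (lhs_mx Z) *m rhs_mx Z.
exists (fun Z => \sum_(m <- msupp p | (mdeg m <= d)%N) p@_m *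
  (\det (lhs_mx Z) ^+ (d - mdeg m) * \prod_k mxvec (C Z) 0 k ^+ m k)).
  apply: homogeneous_sum => m md; apply: homogeneousZ.
  have -> : (n.+1 * d = (d - mdeg m) * (n.+1 * 1) + \sum_k m k * (n.+1 * 1))%N.
    by rewrite -big_distrl -mdegE /= -mulnDl subnK // muln1 mulnC.
  apply: homogeneousM.
    apply: homogeneousX; apply: homogeneous_det => i j.
    by apply: homogeneous_ext (homogeneous_var _ (i, j, false)) => Z; rewrite mxE.
  apply: homogeneous_prod => k; apply: homogeneousX; case/mxvec_indexP: k => i j.
  apply: (@homogeneous_ext _ _ _ (fun Z => \sum_k \adj (lhs_mx Z) i k * rhs_mx Z k j)).
    by move=> Z; rewrite mxvecE mxE.
  apply: homogeneous_sum => k _.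
  rewrite (_ : n.+1 * 1 = n.+1.-1 * 1 + 1)%N; last by rewrite !muln1 addn1.
  apply: homogeneousM.
    apply: homogeneous_adj => i' j'.
    by apply: homogeneous_ext (homogeneous_var _ (i', j', false)) => Z; rewrite mxE.
  by apply: homogeneous_ext (homogeneous_var _ (k, j, true)) => Z; rewrite mxE.
move=> g M Ug.
have lE : lhs_mx (pencil g M) = g by apply/matrixP => i j; rewrite mxE.
have rE : rhs_mx (pencil g M) = M by apply/matrixP => i j; rewrite mxE.
have CE : C (pencil g M) = \det g *: (g^-1 * M).
  rewrite /C lE rE -[g^-1]/(invmx g) /invmx Ug -[_ * M]/(_ *m M).
  by rewrite -scalemxAl scalerA divrr ?scale1r -?unitmxE.
rewrite /eval_mx mevalE mulr_sumr big_seq_cond [RHS]big_seq_cond.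
apply: eq_big => [m|m /andP[mp md]].
  by case mp: (m \in msupp p) => //=; rewrite ltnW // ltnS ltnW // msize_mdeg_lt.
rewrite [RHS]mulrCA; congr (_ * _); rewrite CE lE.
under eq_bigr do rewrite linearZ mxE exprMn.
rewrite big_split /= mulrA prodrXr -mdegE -exprD subnK //.
Qed.

Definition transvection (a b : 'I_n.+1) (s : K) : 'M[K]_n.+1 :=
  1 + s *: delta_mx a b.

Lemma transvectionN a b s : a != b ->
  transvection a b s * transvection a b (- s) = 1.
Proof.
move=> ab; rewrite /transvection mulrDl mul1r mulrDr mulr1 -scalerAl -scalerAr.
rewrite [delta_mx a b * _]mul_delta_mx_0 1?eq_sym // !scaler0 addr0.
by rewrite -addrA -scalerDl addNr scale0r addr0.
Qed.

Lemma transvection_unit a b s : a != b -> transvection a b s \is a GRing.unit.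
Proof.
move=> ab; apply/unitrP; exists (transvection a b (- s)).
split; last exact: transvectionN.
by have := transvectionN (- s) ab; rewrite opprK.
Qed.

Lemma transvection_inv a b s : a != b ->
  (transvection a b s)^-1 = transvection a b (- s).
Proof.
move=> ab; apply: (mulrI (transvection_unit s ab)).
by rewrite divrr ?transvection_unit // transvectionN.
Qed.

Lemma transvection_upper (a b : 'I_n.+1) s : (a < b)%N ->
  upper_unitriangular (transvection a b s).
Proof.
move=> ab; have off i j : (j <= i)%N -> (i == a) && (j == b) = false.
  by move=> ji; apply/negP => /andP[/eqP ia /eqP jb]; rewrite ia jb leqNgt ab in ji.
apply/andP; split; last first.
  by apply/forallP => i; rewrite !mxE eqxx off // mulr0 addr0.
apply/is_trig_mxP => i j ij; rewrite !mxE off ?mulr0 ?addr0 1?ltnW //.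
by case: eqP => // ji; rewrite ji ltnn in ij.
Qed.

Lemma upper_unitriangular_det u : upper_unitriangular u -> \det u = 1.
Proof.
case/andP=> /det_trig det_u /forallP u1.
by rewrite -det_tr det_u big1 // => i _; rewrite mxE; apply/eqP.
Qed.


Lemma mul_mx_deltaE M (a b i j : 'I_n.+1) : (M *m delta_mx a b) i j = (j == b)%:R * M i a.
Proof.
rewrite mxE (bigD1 a) //= big1 ?addr0 => [|k /negbTE ka]; rewrite mxE.
  by rewrite eqxx mulrC.
by rewrite ka mulr0.
Qed.

Lemma mul_delta_mxE M (a b i j : 'I_n.+1) : (delta_mx a b *m M) i j = (i == a)%:R * M b j.
Proof.
rewrite mxE (bigD1 b) //= big1 ?addr0 => [|k /negbTE kb]; rewrite mxE.
  by rewrite eqxx andbT.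
by rewrite kb andbF mul0r.
Qed.

(** Left multiplication of both matrices by [delta_mx a b]. *)
Definition row_gen (a b : 'I_n.+1) (j k : letter) : K :=
  [&& j.1.1 == a, k.1.1 == b, j.1.2 == k.1.2 & j.2 == k.2]%:R.

(** Right multiplication of both matrices by [delta_mx a b]. *)
Definition col_gen (a b : 'I_n.+1) (j k : letter) : K :=
  [&& j.1.2 == b, k.1.2 == a, j.1.1 == k.1.1 & j.2 == k.2]%:R.

Lemma row_genE a b j (G : letter -> K) :
  \sum_k row_gen a b j k * G k = (j.1.1 == a)%:R * G (b, j.1.2, j.2).
Proof.
rewrite (bigD1 (b, j.1.2, j.2)) //= big1 ?addr0 /row_gen /= ?eqxx ?andbT //.
case=> -[k1 k2] k3; rewrite !xpair_eqE /= => kj.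
case: and4P => [[_ /eqP kb /eqP k2E /eqP k3E]|_]; last by rewrite mul0r.
by rewrite kb k2E k3E !eqxx in kj.
Qed.

Lemma col_genE a b j (G : letter -> K) :
  \sum_k col_gen a b j k * G k = (j.1.2 == b)%:R * G (j.1.1, a, j.2).
Proof.
rewrite (bigD1 (j.1.1, a, j.2)) //= big1 ?addr0 /col_gen /= ?eqxx ?andbT //.
case=> -[k1 k2] k3; rewrite !xpair_eqE /= => kj.
case: and4P => [[_ /eqP kb /eqP k2E /eqP k3E]|_]; last by rewrite mul0r.
by rewrite kb k2E k3E !eqxx in kj.
Qed.

Lemma row_gen_tr a b j k : row_gen a b j k = row_gen b a k j.
Proof.
rewrite /row_gen [j.2 == _]eq_sym [j.1.2 == _]eq_sym.
by case: (j.1.1 == a); case: (k.1.1 == b).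
Qed.

Lemma col_gen_tr a b j k : col_gen a b j k = col_gen b a k j.
Proof.
rewrite /col_gen [j.2 == _]eq_sym [j.1.1 == _]eq_sym.
by case: (j.1.2 == b); case: (k.1.2 == a).
Qed.

Lemma adjoint_row_gen a b : adjoint (row_gen a b) = row_gen b a.
Proof.
by apply/funext=> j; apply/funext=> k; rewrite /adjoint row_gen_tr conjC_nat.
Qed.

Lemma adjoint_col_gen a b : adjoint (col_gen a b) = col_gen b a.
Proof.
by apply/funext=> j; apply/funext=> k; rewrite /adjoint col_gen_tr conjC_nat.
Qed.

Lemma shear_row_pencil a b s g M : shear s (row_gen a b) (pencil g M) =
  pencil (transvection a b s * g) (transvection a b s * M).
Proof.
apply/funext=> -[[i j] c]; rewrite /shear row_genE /pencil /=.
by case: c; rewrite mulrDl mul1r -scalerAl mxE [X in _ = _ + X]mxE mul_delta_mxE.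
Qed.

Lemma shear_col_pencil a b s g M : shear s (col_gen a b) (pencil g M) =
  pencil (g * transvection a b s) (M * transvection a b s).
Proof.
apply/funext=> -[[i j] c]; rewrite /shear col_genE /pencil /=.
by case: c; rewrite mulrDr mulr1 -scalerAr mxE [X in _ = _ + X]mxE mul_mx_deltaE.
Qed.

(** The base points [(g, N g)] of the transfer from [U]-invariants on the cone to
    invariants on pairs of matrices: at such a point [g^-1 * (N g)] is conjugate
    to [N]. *)
Definition cone_pencil Z := exists g N,
  [/\ g \is a GRing.unit, nilpotent_mx N & Z = pencil g (N * g)].

Lemma cone_pencil_row a b s Z : a != b ->
  cone_pencil Z -> cone_pencil (shear s (row_gen a b) Z).
Proof.
move=> ab [g [N [Ug nN ->]]]; have Ut := transvection_unit s ab.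
exists (transvection a b s * g), (transvection a b s * N * (transvection a b s)^-1).
split; rewrite ?unitrMr //; first exact: nilpotent_mx_conj.
by rewrite shear_row_pencil !mulrA divrK.
Qed.

Lemma cone_pencil_col a b s Z : a != b ->
  cone_pencil Z -> cone_pencil (shear s (col_gen a b) Z).
Proof.
move=> ab [g [N [Ug nN ->]]]; have Ut := transvection_unit s ab.
exists (g * transvection a b s), N; split; rewrite ?unitrMr //.
by rewrite shear_col_pencil mulrA.
Qed.

Section Transfer.
Variables (p : {mpoly K[n.+1 * n.+1]}) (d : nat) (F : (letter -> K) -> K).
Hypothesis p_inv : forall u N, upper_unitriangular u -> nilpotent_mx N ->
  eval_mx p (u * N * u^-1) = eval_mx p N.
Hypothesis FE : forall g M, g \in unitmx ->
  F (pencil g M) = \det g ^+ d * eval_mx p (g^-1 * M).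

(** A left factor [t] cancels in [(t g)^-1 (t N g)]. *)
Lemma transfer_row (a b : 'I_n.+1) s Z : (a < b)%N ->
  cone_pencil Z -> F (shear s (row_gen a b) Z) = F Z.
Proof.
move=> ab [g [N [Ug nN ->]]]; set t := transvection a b s.
have upper_t : upper_unitriangular t by apply: transvection_upper.
have Ut : t \is a GRing.unit by apply: upper_unitriangular_unit.
have Utg : t * g \is a GRing.unit by rewrite unitrMr.
rewrite shear_row_pencil !FE // -/t -[t * g]/(t *m g) det_mulmx.
rewrite [\det t]upper_unitriangular_det // mul1r -[t *m g]/(t * g).
by rewrite invrM // -mulrA mulKr.
Qed.

(** A right factor [t] conjugates the nilpotent matrix [g^-1 N g], which is where
    the invariance of [p] on the cone is used. *)
Lemma transfer_col (a b : 'I_n.+1) s Z : (a < b)%N ->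
  cone_pencil Z -> F (shear s (col_gen a b) Z) = F Z.
Proof.
move=> ab [g [N [Ug nN ->]]]; set t := transvection a b s.
have ab' : a != b by apply: contraTneq ab => ->; rewrite ltnn.
have upper_t : upper_unitriangular t by apply: transvection_upper.
have Ut : t \is a GRing.unit by apply: upper_unitriangular_unit.
have Ugt : g * t \is a GRing.unit by rewrite unitrMr.
rewrite shear_col_pencil !FE // -/t -[g * t]/(g *m t) det_mulmx.
rewrite [\det t]upper_unitriangular_det // mulr1 -[g *m t]/(g * t).
congr (_ * _); have nN' : nilpotent_mx (g^-1 * N * g).
  by rewrite -{2}[g]invrK; apply: nilpotent_mx_conj; rewrite ?unitrV.
have upper_t' : upper_unitriangular t^-1.
  by rewrite transvection_inv //; apply: transvection_upper.
by rewrite invrM // [g^-1 * (N * g)]mulrA -(p_inv upper_t' nN') invrK !mulrA.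
Qed.

End Transfer.
End HardDirection.

(** * Invariants lie in the span *)

Section Spanning.
Variables (K : numClosedFieldType) (n : nat).
Local Notation letter := ('I_n.+1 * 'I_n.+1 * bool)%type.

Section Slots.
Variable r : nat.
Local Notation X := 'I_r.
Local Notation word := {ffun X -> 'I_n.+1}.
Local Notation colors := {ffun X -> bool}.

(** The rows are read from the last one, so that the upper triangular group acts
    on the row letters [v] and on the column letters [w] in the same way. *)
Definition join (v w : word) (c : colors) : {ffun X -> letter} :=
  [ffun x => (rev_ord (v x), w x, c x)].

Lemma join_upd_row v w c x a :
  join (upd v x a) w c = upd (join v w c) x (rev_ord a, w x, c x).
Proof. by apply/ffunP => z; rewrite !ffunE; case: eqP => [->|]. Qed.

Lemma join_upd_col v w c x a :
  join v (upd w x a) c = upd (join v w c) x (rev_ord (v x), a, c x).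
Proof. by apply/ffunP => z; rewrite !ffunE; case: eqP => [->|]. Qed.

Lemma sum_join (G : {ffun X -> letter} -> K) :
  \sum_f G f = \sum_c \sum_v \sum_w G (join v w c).
Proof.
rewrite (reindex (fun t : colors * (word * word) => join t.2.1 t.2.2 t.1)) /=.
  by under [RHS]eq_bigr do rewrite pair_bigA; rewrite pair_bigA.
pose unjoin (f : {ffun X -> letter}) : colors * (word * word) :=
  ([ffun x => (f x).2], ([ffun x => rev_ord (f x).1.1], [ffun x => (f x).1.2])).
apply: onW_bij; exists unjoin => [[c [v w]]|f] /=.
  by congr (_, (_, _)); apply/ffunP => x; rewrite !ffunE ?rev_ordK.
apply/ffunP => x; rewrite !ffunE rev_ordK.
by case: (f x) => -[].
Qed.

Lemma join_highest_row (T : {ffun X -> letter} -> K) (w : word) (c : colors) :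
  (forall (a b : 'I_n.+1), (a < b)%N ->
     forall f : {ffun X -> letter},
       \sum_x \sum_j row_gen K a b j (f x) * T (upd f x j) = 0) ->
  highest [set: X] (fun v => T (join v w c)).
Proof.
move=> T_inv a b ab v.
have rev_ab : (rev_ord b < rev_ord a)%N by rewrite /= ab; have := ltn_ord b; lia.
rewrite -[RHS](T_inv _ _ rev_ab (join v w c)) /polarize big_mkcond /=.
apply: eq_bigr => x _; rewrite inE /=.
under [RHS]eq_bigr do rewrite row_gen_tr.
rewrite row_genE ffunE /= (inj_eq rev_ord_inj) join_upd_row.
by case: eqP; rewrite ?mul1r ?mul0r.
Qed.

Lemma join_highest_col (T : {ffun X -> letter} -> K) (v : word) (c : colors) :
  (forall (a b : 'I_n.+1), (a < b)%N ->
     forall f : {ffun X -> letter},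
       \sum_x \sum_j col_gen K a b j (f x) * T (upd f x j) = 0) ->
  highest [set: X] (fun w => T (join v w c)).
Proof.
move=> T_inv a b ab w.
have lt_ab : (a < b)%N by rewrite ab.
rewrite -[RHS](T_inv _ _ lt_ab (join v w c)) /polarize big_mkcond /=.
apply: eq_bigr => x _; rewrite inE /=.
under [RHS]eq_bigr do rewrite col_gen_tr.
rewrite col_genE ffunE /= join_upd_col.
by case: eqP; rewrite ?mul1r ?mul0r.
Qed.

End Slots.

Lemma U_invariant_in_span (f : nilpotent_cone K n -> K) :
  U_invariant_ring f -> in_span (@datum_fun K n) f.
Proof.
move=> [[p fp] f_inv].
have p_inv u N : upper_unitriangular u -> nilpotent_mx N ->
    eval_mx p (u * N * u^-1) = eval_mx p N.
  move=> Uu nN; rewrite /eval_mx -(fp (exist _ N nN)).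
  by rewrite -(f_inv u Uu) fp.
have [d d_gt0 [F homF FE]] := clear_denominators p.
have [T0 FT0] := homogeneous_form_of (ord0, ord0, false) homF.
move: (n.+1 * d)%N (muln_gt0 n.+1 d) T0 FT0 {homF} => r.
rewrite d_gt0 /= => r_gt0 T0 FT0.
have [T TE T_inv] := @invariant_tensor K _ _ (@cone_pencil K n) T0.
have T_row (a b : 'I_n.+1) : (a < b)%N ->
    forall g : {ffun 'I_r -> letter},
      \sum_x \sum_j row_gen K a b j (g x) * T (upd g x j) = 0.
  move=> ab; have ab' : a != b by apply: contraTneq ab => ->; rewrite ltnn.
  apply: T_inv => s Z YZ.
    by rewrite adjoint_row_gen; split; apply: cone_pencil_row; rewrite // eq_sym.
  by rewrite -!FT0; exact: (transfer_row FE).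
have T_col (a b : 'I_n.+1) : (a < b)%N ->
    forall g : {ffun 'I_r -> letter},
      \sum_x \sum_j col_gen K a b j (g x) * T (upd g x j) = 0.
  move=> ab; have ab' : a != b by apply: contraTneq ab => ->; rewrite ltnn.
  apply: T_inv => s Z YZ.
    by rewrite adjoint_col_gen; split; apply: cone_pencil_col; rewrite // eq_sym.
  by rewrite -!FT0; exact: (transfer_col p_inv FE).
have [M ME] := choice (fun c => in_span_tensor
  (fun w => highest_span (join_highest_row w c T_row))
  (fun v => highest_span (join_highest_col v c T_col))).
pose G (A B : full_tableau n.+1 'I_r) c (N : nilpotent_cone K n) :=
  \sum_(S : {set 'I_r}) (-1) ^+ #|~: S| *
    \det (box_mx (sval A) (sval B) c S (pencil 1 (sval N))).
have G_span A B c : in_span (@datum_fun K n) (G A B c).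
  apply: in_span_sum => S _; apply: in_spanZ.
  have [P [b bE]] := box_mx_datum K r_gt0 A B c S.
  apply: in_span_ext (in_spanZ ((-1) ^+ b) (in_span_gen _ P)) => N.
  by rewrite bE.
have f_sum N : \sum_c \sum_A \sum_B M c A B * G A B c N = f N.
  have Y_N : cone_pencil (pencil 1 (sval N)).
    by exists 1, (sval N); rewrite unitr1 mulr1; split=> //; apply: svalP.
  (* At the base point [(1, N)] the form [F] takes the value [f N]. *)
  have -> : f N = form_of T (pencil 1 (sval N)).
    rewrite TE // -FT0 FE ?unitmx1 // det1 expr1n mul1r invr1 mul1r.
    exact: fp.
  rewrite /form_of sum_join; apply: eq_bigr => c _.
  under [RHS]eq_bigr do under eq_bigr do rewrite ME.
  set Z := pencil 1 (sval N).
  transitivity (\sum_A \sum_B M c A B * (\sum_v \sum_w full_tensor K A v *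
      (full_tensor K B w * monomial Z (join v w c)))).
    apply: eq_bigr => A _; apply: eq_bigr => B _; congr (_ * _).
    rewrite /G -pairing_sum_det; apply: eq_bigr => v _; apply: eq_bigr => w _.
    congr (_ * (_ * _)); apply: eq_bigr => x _; by rewrite ffunE.
  under [RHS]eq_bigr do under eq_bigr do rewrite mulr_suml.
  under [RHS]eq_bigr do rewrite exchange_big.
  rewrite [RHS]exchange_big /=; apply: eq_bigr => A _.
  under [RHS]eq_bigr do under eq_bigr do rewrite mulr_suml.
  under [RHS]eq_bigr do rewrite exchange_big.
  rewrite [RHS]exchange_big /=; apply: eq_bigr => B _.
  rewrite mulr_sumr; apply: eq_bigr => v _.
  rewrite mulr_sumr; apply: eq_bigr => w _.
  by rewrite !mulrA.
apply: in_span_ext f_sum _.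
apply: in_span_sum => c _; apply: in_span_sum => A _; apply: in_span_sum => B _.
exact: in_spanZ.
Qed.

End Spanning.

(** * Functions of data are regular and invariant *)

Section EasyDirection.
Variables (K : fieldType) (n : nat).
Implicit Types (M N u v : 'M[K]_n.+1) (P : datum K n).

Definition polynomial_function (F : 'M[K]_n.+1 -> K) :=
  exists p : {mpoly K[n.+1 * n.+1]}, forall N, F N = p.@[fun k => mxvec N 0 k].

Lemma polynomial_function_ext F G :
  F =1 G -> polynomial_function F -> polynomial_function G.
Proof. by move=> FG [p pE]; exists p => N; rewrite -FG. Qed.

Lemma polynomial_function_const a : polynomial_function (fun=> a).
Proof. by exists a%:MP => N; rewrite mevalC. Qed.

Lemma polynomial_function_entry i j : polynomial_function (fun N => N i j).
Proof. by exists 'X_(mxvec_index i j) => N; rewrite mevalXU mxvecE. Qed.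

Lemma polynomial_functionD F G : polynomial_function F ->
  polynomial_function G -> polynomial_function (fun N => F N + G N).
Proof. by move=> [p pE] [q qE]; exists (p + q) => N; rewrite mevalD pE qE. Qed.

Lemma polynomial_functionM F G : polynomial_function F ->
  polynomial_function G -> polynomial_function (fun N => F N * G N).
Proof. by move=> [p pE] [q qE]; exists (p * q) => N; rewrite mevalM pE qE. Qed.

Lemma polynomial_function_sum (I : Type) (r : seq I)
    (F : I -> 'M[K]_n.+1 -> K) : (forall i, polynomial_function (F i)) ->
  polynomial_function (fun N => \sum_(i <- r) F i N).
Proof.
move=> polF; elim: r => [|i r IHr].
  by apply: polynomial_function_ext (polynomial_function_const 0) => N; rewrite big_nil.
apply: polynomial_function_ext (polynomial_functionD (polF i) IHr) => N.
by rewrite big_cons.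
Qed.

Lemma polynomial_function_prod (I : Type) (r : seq I)
    (F : I -> 'M[K]_n.+1 -> K) : (forall i, polynomial_function (F i)) ->
  polynomial_function (fun N => \prod_(i <- r) F i N).
Proof.
move=> polF; elim: r => [|i r IHr].
  by apply: polynomial_function_ext (polynomial_function_const 1) => N; rewrite big_nil.
apply: polynomial_function_ext (polynomial_functionM (polF i) IHr) => N.
by rewrite big_cons.
Qed.

Lemma polynomial_function_horner q i j :
  polynomial_function (fun N => horner_mx N q i j).
Proof.
elim/poly_ind: q i j => [|q c IHq] i j.
  apply: polynomial_function_ext (polynomial_function_const 0) => N.
  by rewrite rmorph0 mxE.
apply: (@polynomial_function_ext (fun N =>
    \sum_k horner_mx N q i k * N k j + c%:M i j)) => [N|].
  by rewrite rmorphD rmorphM /= horner_mx_X horner_mx_C [RHS]mxE [in RHS]mxE.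
apply: polynomial_functionD; last exact: polynomial_function_const.
apply: polynomial_function_sum => k; apply: polynomial_functionM => //.
exact: polynomial_function_entry.
Qed.

Lemma datum_fun_regular P : regular_function (datum_fun P).
Proof.
suff [p pE] : polynomial_function (fun N => \det (datum_mx P N)).
  by exists p => N; apply: pE.
apply: polynomial_function_sum => s.
apply: polynomial_functionM; first exact: polynomial_function_const.
apply: polynomial_function_prod => i.
pose j := cast_ord (sum_sizes P) (s i).
apply: polynomial_function_ext (polynomial_function_horner
  (datum_poly P (tagnat.sig1 i) (tagnat.sig1 j))
  (inord (n.+1 - row_size P (tagnat.sig1 i) + tagnat.sig2 i))
  (inord (tagnat.sig2 j))) => N.
rewrite castmxE /= cast_ord_id !mxE /j.
by rewrite (_ : cast_ord (esym (esym (sum_sizes P))) (s i) = j) //; apply: val_inj.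
Qed.

Definition lower_corner u a : 'M[K]_a :=
  \matrix_(i, j) u (inord (n.+1 - a + i)) (inord (n.+1 - a + j)).

Definition upper_corner u b : 'M[K]_b := \matrix_(i, j) u (inord i) (inord j).

Lemma upper_triangularP u (i j : 'I_n.+1) :
  is_trig_mx u^T -> (j < i)%N -> u i j = 0.
Proof. by move=> /is_trig_mxP/(_ j i) + ji => /(_ ji); rewrite mxE. Qed.

Lemma sum_split_ord m a (F : 'I_n.+1 -> K) : (m + a = n.+1)%N ->
  \sum_k F k = \sum_(k < m) F (inord k) + \sum_(k < a) F (inord (m + k)).
Proof.
move=> ma; transitivity (\sum_(0 <= k < n.+1) F (inord k)).
  by rewrite big_mkord; apply: eq_bigr => k _; rewrite inord_val.
rewrite (@big_cat_nat _ _ _ m) //=; last by rewrite -ma leq_addr.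
rewrite big_mkord; congr (_ + _).
rewrite -[X in \sum_(X <= _ < _) _]add0n big_addn.
rewrite (_ : n.+1 - m = a)%N; last by rewrite -ma addKn.
by rewrite big_mkord; apply: eq_bigr => k _; rewrite addnC.
Qed.

(** The last rows of [u] vanish except in the last columns. *)
Lemma corner_mull u M a b : (a <= n.+1)%N -> is_trig_mx u^T ->
  corner_mx (u * M) a b = lower_corner u a *m corner_mx M a b.
Proof.
move=> an u_trig; apply/matrixP => i j; rewrite !mxE.
rewrite (sum_split_ord _ (subnK an)) big1 ?add0r => [|k _].
  by apply: eq_bigr => k _; rewrite !mxE.
rewrite (upper_triangularP u_trig) ?mul0r //.
have ka := ltn_ord k; have ia := ltn_ord i.
by rewrite /= !inordK; lia.
Qed.

(** The first columns of [v] vanish except in the first rows. *)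
Lemma corner_mulr v M a b : (b <= n.+1)%N -> is_trig_mx v^T ->
  corner_mx (M * v) a b = corner_mx M a b *m upper_corner v b.
Proof.
move=> bn v_trig; apply/matrixP => i j; rewrite !mxE.
rewrite (sum_split_ord _ (subnKC bn)) [X in _ + X]big1 ?addr0 => [|k _].
  by apply: eq_bigr => k _; rewrite !mxE.
rewrite (upper_triangularP v_trig) ?mulr0 //.
have kb := ltn_ord k; have jb := ltn_ord j.
by rewrite /= !inordK; lia.
Qed.

Lemma det_mxdiag_unitriangular m (a : 'I_m -> nat) (B : forall i, 'M[K]_(a i)) :
  (forall i, is_trig_mx (B i)^T) -> (forall i j, B i j j = 1) ->
  \det (\mxdiag_i B i) = 1.
Proof.
move=> B_trig B1; rewrite -det_tr tr_mxdiag det_trig => [|].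
  by apply: big1 => s _; rewrite !mxE eqxx conform_mx_id mxE B1.
apply/is_trig_mxblockP; split=> [i j ij|i]; last by rewrite eqxx conform_mx_id.
by case: eqP => // e; rewrite e ltnn in ij.
Qed.

Lemma lower_corner_trig u a : (a <= n.+1)%N -> is_trig_mx u^T ->
  is_trig_mx (lower_corner u a)^T.
Proof.
move=> an u_trig; apply/is_trig_mxP => j k jk; rewrite !mxE.
have {}jk : (j < k)%N := jk; have ka := ltn_ord k.
by rewrite (upper_triangularP u_trig) // !inordK; lia.
Qed.

Lemma upper_corner_trig u b : (b <= n.+1)%N -> is_trig_mx u^T ->
  is_trig_mx (upper_corner u b)^T.
Proof.
move=> bn u_trig; apply/is_trig_mxP => j k jk; rewrite !mxE.
have {}jk : (j < k)%N := jk; have kb := ltn_ord k.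
by rewrite (upper_triangularP u_trig) // !inordK; lia.
Qed.

Lemma lower_corner_det m (a : 'I_m -> nat) u : (forall i, (a i <= n.+1)%N) ->
  upper_unitriangular u -> \det (\mxdiag_i lower_corner u (a i)) = 1.
Proof.
move=> an /andP[u_trig /forallP u1]; apply: det_mxdiag_unitriangular => i.
  exact: lower_corner_trig.
by move=> j; rewrite mxE; apply/eqP.
Qed.

Lemma upper_corner_det m (b : 'I_m -> nat) u : (forall i, (b i <= n.+1)%N) ->
  upper_unitriangular u -> \det (\mxdiag_i upper_corner u (b i)) = 1.
Proof.
move=> bn /andP[u_trig /forallP u1]; apply: det_mxdiag_unitriangular => i.
  exact: upper_corner_trig.
by move=> j; rewrite mxE; apply/eqP.
Qed.

Lemma det_castmx_mull m q (e : q = m) (C : 'M[K]_m) (B : 'M[K]_(m, q)) :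
  \det (castmx (erefl m, e) (C *m B)) = \det C * \det (castmx (erefl m, e) B).
Proof. by subst q; rewrite !castmx_id det_mulmx. Qed.

Lemma det_castmx_mulr m q (e : q = m) (B : 'M[K]_(m, q)) (D : 'M[K]_q) :
  \det (castmx (erefl m, e) (B *m D)) = \det (castmx (erefl m, e) B) * \det D.
Proof. by subst q; rewrite !castmx_id det_mulmx. Qed.

Lemma horner_mx_conj u N q : u \is a GRing.unit ->
  horner_mx (u * N * u^-1) q * u = u * horner_mx N q.
Proof.
move=> Uu; elim/poly_ind: q => [|q c IHq]; first by rewrite !rmorph0 mulr0 mul0r.
rewrite !rmorphD !rmorphM /= !horner_mx_X !horner_mx_C mulrDr mulrDl.
congr (_ + _); last exact/esym/scalar_mxC.
by rewrite mulrA divrK // mulrA IHq mulrA.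
Qed.

(** A polynomial in [u N u^-1] is conjugated by [u] as well. Moving [u] to the right
    hand side turns this into an identity of block matrices, multiplied by block
    diagonal matrices of determinant 1. *)
Lemma datum_fun_invariant P : U_invariant (datum_fun P).
Proof.
move=> u Uu [N nN]; rewrite /datum_fun /= /datum_mx.
have unit_u := upper_unitriangular_unit Uu.
have an i : (row_size P i <= n.+1)%N by case/andP: (row_size_bound i).
have bn j : (col_size P j <= n.+1)%N by case/andP: (col_size_bound j).
have u_trig : is_trig_mx u^T by case/andP: Uu.
rewrite -[LHS]mulr1 -(upper_corner_det bn Uu) -det_castmx_mulr.
rewrite -[RHS]mul1r -(lower_corner_det an Uu) -det_castmx_mull.
rewrite mul_mxblock_mxdiag mul_mxdiag_mxblock; congr (\det (castmx _ _)).
apply: eq_mxblock => i j.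
by rewrite -corner_mulr // -corner_mull // horner_mx_conj.
Qed.

Lemma span_U_invariant (f : nilpotent_cone K n -> K) :
  in_span (@datum_fun K n) f -> U_invariant_ring f.
Proof.
move=> [m [c [P fE]]]; split; last first.
  move=> u Uu N; rewrite !fE; apply: eq_bigr => k _.
  by rewrite datum_fun_invariant.
have [p pE] := choice (fun k => datum_fun_regular (P k)).
exists (\sum_(k < m) c k *: p k) => N; rewrite fE raddf_sum.
by apply: eq_bigr => k _; rewrite /= mevalZ -pE.
Qed.

End EasyDirection.

Theorem corollary5p3 (R : realType) (n : nat) (f : nilpotent_cone (complex R) n -> complex R) :
  U_invariant_ring f <-> in_span (@datum_fun (complex R) n) f.
Proof. by split; [exact: U_invariant_in_span | exact: span_U_invariant]. Qed.
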